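(* Let $d\ge3$, $\gamma>-1$, $1\le p\le d$, let $k_1,k_2,k_3,k_4\in\{1,\dots,d+1\}$ be distinct, and let $a>0$, $a\ne1$. Suppose $$A_5=\frac{m_{\{3,1\}}-2m_{\{2,2\}}}{a(a-1)^2p}$$ and that the following system holds with $A_1,A_2,A_3,A_4$ positive: \begin{align*} \sum_{j=1}^4A_jk_j+A_5(a^4+p)&=m_{\{4\}},\\ \sum_{j=1}^4A_j\binom{k_j}{2}+A_5\Big(a^2p+\binom p2\Big)&=m_{\{2,2\}},\\ 3\sum_{j=1}^4A_j\binom{k_j}{3}+A_5\Big((a^2+2a)\binom p2+3\binom p3\Big)&=m_{\{2,1,1\}},\\ \sum_{j=1}^4A_j\binom{k_j}{4}+A_5\Big(a\binom p3+\binom p4\Big)&=m_{\{1,1,1,1\}}. \end{align*} Then $$ w_\gamma\int_{\mathcal{T}^{d+1}}f(\xi)\xi^\gamma d\xi=\sum_{j=1}^4\frac{A_j}{\binom{d+1}{k_j}}\sum_{x\in v_{k_j}S_{d+1}}f(x)+\frac{A_5}{(d+1)\binom dp}\sum_{x\in u_{a,p}S_{d+1}}f(x) $$ is a positive cubature rule of index $4$, i.e. it holds for all homogeneous polynomials $f$ of degree $4$ in $d+1$ variables. Furthermore, with $\lambda_j=A_jk_j^4$ $(1\le j\le4)$ and $\lambda_5=A_5(a+p)^4$, the rule $$ w_\gamma\int_{\mathcal{T}^{d+1}}f(\xi)\xi^\gamma d\xi=\sum_{j=1}^4\frac{\lambda_j}{\binom{d+1}{k_j}}\sum_{x\in v_{k_j}S_{d+1}}f\Big(\frac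 x{k_j}\Big)+\frac{\lambda_5}{(d+1)\binom dp}\sum_{x\in u_{a,p}S_{d+1}}f\Big(\frac x{a+p}\Big) $$ is a positive cubature rule of index $4$ with all nodes in $\mathcal{T}^{d+1}$.
   Context: $T^d=\{x\in\mathbb{R}^d:x_i\ge0,\ |x|_1\le1\}$ with $|x|_1=x_1+\dots+x_d$, and $\mathcal{T}^{d+1}=\{\xi\in\mathbb{R}^{d+1}:\xi_i\ge0,\ \xi_1+\dots+\xi_{d+1}=1\}$; $\int_{\mathcal{T}^{d+1}}f(\xi)\xi^\gamma d\xi:=\int_{T^d}f(x,1-|x|_1)(x_1\cdots x_d(1-|x|_1))^\gamma dx$, and $w_\gamma$ is the constant making $w_\gamma\int_{\mathcal{T}^{d+1}}\xi^\gamma d\xi=1$. $v_k=(1,\dots,1,0,\dots,0)\in\mathbb{R}^{d+1}$ ($k$ ones); $u_{a,p}=(a,1,\dots,1,0,\dots,0)\in\mathbb{R}^{d+1}$ ($p$ ones after $a$); $yS_{d+1}$ is the set of distinct points obtained from $y$ by permuting coordinates. For a partition $\ell=(\ell_1\ge\dots\ge\ell_r>0)$, $S_{\{\ell\}}(x)$ is the monomial symmetric polynomial in $x_1,\dots,x_{d+1}$ (sum of all distinct monomials obtained from $x_1^{\ell_1}\cdots x_r^{\ell_r}$ by permuting variables), and $m_{\{\ell\}}=w_\gamma\int_{\mathcal{T}^{d+1}}S_{\{\ell\}}(\xi)\xi^\gamma d\xi$. A cubature rule is positive if all its weights are positive. *)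

(* Defs.v *)
From HB Require Import structures.
From mathcomp Require Import all_boot all_order all_algebra all_fingroup.
(* The notations of mpoly clash with those of all_analysis. *)
From mathcomp Require Import -(notations) mpoly.
From mathcomp Require Import all_classical all_reals all_analysis.

Set Warnings "-redundant-canonical-projection,-notation-overridden,-ambiguous-paths".

Set Implicit Arguments.
Unset Strict Implicit.
Unset Printing Implicit Defensive.

Import Order.TTheory GRing.Theory Num.Theory.
Import numFieldNormedType.Exports.

Local Open Scope classical_set_scope.
Local Open Scope ring_scope.

(* The Lebesgue measure on R^n, n-tuples of reals carrying the product
   sigma-algebra: the Dirac mass on the one-point space R^0, and on R^(n+1)
   the image of lebesgue_measure \x leb n under (x, t) |-> x :: t.            *)
Section lebesgue_tuple.
Context {R : realType}.
Local Notation T := (measurableTypeR R).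

Definition tuple_cons n (p : T * n.-tuple T) : n.+1.-tuple T :=
  [the n.+1.-tuple T of p.1 :: p.2].

Lemma measurable_tuple_cons n : measurable_fun [set: T * n.-tuple T] (@tuple_cons n).
Proof. exact: measurable_cons. Qed.

Section succ.
Context n (m : {sigma_finite_measure set (n.-tuple T) -> \bar R}).

Definition leb_succ : set (n.+1.-tuple T) -> \bar R :=
  pushforward (@lebesgue_measure R \x m)%E (@tuple_cons n).

Let leb_succ0 : leb_succ set0 = 0%E.
Proof. by rewrite /leb_succ /pushforward preimage_set0 measure0. Qed.

Let leb_succ_ge0 A : (0 <= leb_succ A)%E.
Proof. by rewrite /leb_succ /pushforward; exact: measure_ge0. Qed.

Let leb_succ_sigma_additive : semi_sigma_additive leb_succ.
Proof.
move=> F mF tF mUF; rewrite /leb_succ /pushforward preimage_bigcup.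
apply: measure_semi_sigma_additive.
- by move=> k; rewrite -[X in measurable X]setTI; exact: measurable_tuple_cons.
- apply/trivIsetP => /= i j _ _ ij; rewrite -preimage_setI.
  by move/trivIsetP : tF => /(_ _ _ _ _ ij) ->//; rewrite preimage_set0.
- rewrite -preimage_bigcup -[X in measurable X]setTI.
  exact: measurable_tuple_cons.
Qed.

HB.instance Definition _ := isMeasure.Build _ _ _ leb_succ
  leb_succ0 leb_succ_ge0 leb_succ_sigma_additive.

Let leb_succ_sigma_finite : sigma_finite setT leb_succ.
Proof.
have /sigma_finiteP[F [FT Fnd Foo]] := sigma_finiteT (@lebesgue_measure R).
have /sigma_finiteP[G [GT Gnd Goo]] := sigma_finiteT m.
pose g (t : n.+1.-tuple T) : T * n.-tuple T := (thead t, [tuple of behead t]).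
have gK p : g (tuple_cons p) = p.
  by case: p => x t; congr (_, _); exact/val_inj.
have mg : measurable_fun setT g.
  apply/measurable_fun_pairP; split; first exact: measurable_tnth.
  exact: measurable_behead.
exists (fun k => g @^-1` (F k `*` G k)).
  apply/seteqP; split => // t _.
  have [i _ Fi] : (\bigcup_k F k) (g t).1 by rewrite -FT.
  have [j _ Gj] : (\bigcup_k G k) (g t).2 by rewrite -GT.
  exists (maxn i j) => //; split.
  - by move: Fi; exact/subsetPset/Fnd/leq_maxl.
  - by move: Gj; exact/subsetPset/Gnd/leq_maxr.
move=> k; have [mF Fkoo] := Foo k; have [mG Gkoo] := Goo k; split.
  by rewrite -[X in measurable X]setTI; apply: mg => //; exact: measurableX.
have -> : leb_succ (g @^-1` (F k `*` G k)) =
    (@lebesgue_measure R \x m)%E (F k `*` G k).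
  rewrite /leb_succ /pushforward -comp_preimage.
  by rewrite (_ : g \o @tuple_cons n = id) ?preimage_id//; exact/funext.
by rewrite product_measure1E// lte_mul_pinfty// ge0_fin_numE.
Qed.

HB.instance Definition _ := @Measure_isSigmaFinite.Build _ _ _
  leb_succ leb_succ_sigma_finite.

End succ.

Fixpoint leb n : {sigma_finite_measure set (n.-tuple T) -> \bar R} :=
  if n is n'.+1 then [the {sigma_finite_measure set _ -> \bar R} of leb_succ (leb n')]
  else [the {sigma_finite_measure set _ -> \bar R} of \d_([tuple] : 0.-tuple T)].

End lebesgue_tuple.

Section simplex.
Context {R : realType}.
Variable d : nat.

Definition solid_simplex : set (d.-tuple (measurableTypeR R)) :=
  [set x | (forall i, 0 <= tnth x i) /\ \sum_i tnth x i <= 1].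

Definition simplex : set 'rV[R]_d.+1 :=
  [set xi | (forall i, 0 <= xi 0 i) /\ \sum_i xi 0 i = 1].

Definition simplex_lift (x : d.-tuple R) : 'rV[R]_d.+1 :=
  \row_i tnth [tuple of rcons x (1 - \sum_j tnth x j)] i.

(* The integral of f(xi) xi^gamma over the simplex, in the coordinates given
   by simplex_lift. On the boundary, a null set, 0 `^ gamma takes its library
   value instead of being infinite when gamma < 0.                           *)
Definition simplex_integral (gamma : R) (f : 'rV[R]_d.+1 -> R) : R :=
  \int[leb d]_(x in solid_simplex)
    (f (simplex_lift x) * (\prod_i simplex_lift x 0 i) `^ gamma).

(* w_gamma; for gamma > -1 the integral is finite and positive. *)
Definition simplex_const (gamma : R) : R :=
  (simplex_integral gamma (fun=> 1))^-1.

Definition simplex_mean (gamma : R) (f : 'rV[R]_d.+1 -> R) : R :=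
  simplex_const gamma * simplex_integral gamma f.

Definition poly_eval (f : mpoly d.+1 R) (x : 'rV[R]_d.+1) : R :=
  meval (fun i => x 0 i) f.

Definition homogeneous (s : nat) (f : mpoly d.+1 R) : Prop :=
  f \is ishomog1 s mdeg.

(* undup keeps each permuted monomial once; l is padded with zeros. *)
Definition monomial_sym (l : seq nat) : mpoly d.+1 R :=
  \sum_(m <- undup [seq Multinom [tuple nth 0%N l (s i) | i < d.+1]
                       | s : 'S_d.+1]) mpolyX R m.

Definition moment (gamma : R) (l : seq nat) : R :=
  simplex_mean gamma (poly_eval (monomial_sym l)).

Definition vpt (k : nat) : 'rV[R]_d.+1 := \row_i (i < k)%N%:R.

Definition upt (a : R) (p : nat) : 'rV[R]_d.+1 :=
  \row_i (if i == 0%N :> nat then a else (i <= p)%N%:R).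

Definition orbit_pts (y : 'rV[R]_d.+1) : seq 'rV[R]_d.+1 :=
  undup [seq col_perm s y | s : 'S_d.+1].

End simplex.

(* Main.v *)
(* The mean over the simplex and the cubature sum are both linear forms on
   polynomials, and both are invariant under permutations of the d + 1
   variables. A monomial of degree 4 is a permutation of one of five monomials
   x^l, l a partition of 4, so the two forms agree in degree 4 as soon as they
   agree on the five symmetric polynomials S_l. Expanding S_l over the supports
   of its monomials gives its values at the nodes, and four of the five
   equations are the hypotheses. The equation for {3,1} follows from the one for
   {2,2}, since S_{3,1} - 2 S_{2,2} = sum_{i<j} x_i x_j (x_i - x_j)^2 vanishes at
   each v_k and equals a (a - 1)^2 p at u_{a,p}; this is the choice of A_5. The
   same expression is nonnegative on the simplex, so that A_5 > 0.
   The invariance of the mean is an invariance of Lebesgue measure: exchanging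
   two consecutive coordinates x_i is Tonelli's theorem, and exchanging x_d with
   1 - |x|_1 is a reflection in x_d. *)
Require Import Defs.
From mathcomp Require Import all_boot all_order all_algebra all_fingroup.
From mathcomp Require Import -(notations) mpoly.
From mathcomp Require Import all_classical all_reals all_analysis.
From mathcomp Require Import measurable_realfun.
From mathcomp Require Import ring lra zify.

Set Implicit Arguments.
Unset Strict Implicit.
Unset Printing Implicit Defensive.

Import Order.TTheory GRing.Theory Num.Theory.
Import numFieldNormedType.Exports.
Local Open Scope ring_scope.

(** * Rearrangements of sequences with two or three distinct values *)

Section permutation_patterns.
Variables (n : nat) (T V : eqType).

(** List [t] first and the other indices after it: the position in this list is the required
    permutation. The permutations with a prescribed pattern below come from suitable choices of
    [t]. *)
Lemma perm_index (t : seq 'I_n) : uniq t ->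
  exists s : 'S_n, (forall x, x \in t -> s x = index x t :> nat) /\
                   (forall x, x \notin t -> (size t <= s x)%N).
Proof.
move=> ut; pose u := t ++ [seq x <- enum 'I_n | x \notin t].
have uu : uniq u.
  rewrite cat_uniq ut filter_uniq ?enum_uniq// andbT.
  by apply/hasPn => x; rewrite mem_filter => /andP[].
have um x : x \in u by rewrite mem_cat mem_filter mem_enum andbT orbN.
have su : size u = n.
  rewrite -[RHS]card_ord cardE; apply: perm_size; apply: uniq_perm => //.
    exact: enum_uniq.
  by move=> x; rewrite um mem_enum.
have lt x : (index x u < n)%N by rewrite -[X in (_ < X)%N]su index_mem.
pose f x := Ordinal (lt x).
have injf : injective f.
  move=> x y /(congr1 val)/= /(congr1 (nth x u)).
  by rewrite !nth_index.
exists (perm injf); split=> x xt; rewrite permE/= index_cat.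
  by rewrite xt.
by rewrite (negbTE xt) leq_addr.
Qed.

Lemma perm_to_prefix (B : {set 'I_n}) r : #|B| = r ->
  exists s : 'S_n, forall x, (s x < r)%N = (x \in B).
Proof.
move=> Br; have [s [sB sNB]] := perm_index (enum_uniq B).
exists s => x; rewrite -Br cardE -(mem_enum B).
have [xB|xB] := boolP (x \in enum B); first by rewrite sB// index_mem.
by apply/negbTE; rewrite -leqNgt sNB.
Qed.

Lemma perm_to_pointed_prefix (i : 'I_n) (B : {set 'I_n}) r : i \in B -> #|B| = r ->
  exists s : 'S_n, (forall x, (s x < r)%N = (x \in B)) /\
                   (forall x, (s x == 0%N :> nat) = (x == i)).
Proof.
move=> iB Br; pose t := i :: enum (B :\ i).
have ut : uniq t by rewrite /= mem_enum setD11 enum_uniq.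
have tB x : (x \in t) = (x \in B).
  by rewrite inE mem_enum in_setD1; case: eqVneq => [->|].
have st : size t = r by rewrite /= -cardE -Br [in RHS](cardsD1 i) iB.
have [s [sB sNB]] := perm_index ut.
have s0 x : (s x == 0%N :> nat) = (x == i).
  have [xt|xt] := boolP (x \in t).
    by rewrite sB// /= [x == i]eq_sym; case: (i == x).
  rewrite -leqn0 leqNgt (leq_trans _ (sNB _ xt))//; apply/esym.
  by apply: contraNF xt => /eqP ->; rewrite tB.
exists s; split => // x; rewrite -tB.
have [xt|xt] := boolP (x \in t); first by rewrite sB// -st index_mem.
by apply/negbTE; rewrite -leqNgt -st sNB.
Qed.

Lemma card_ltn_ord r : (r <= n)%N -> #|[set i : 'I_n | (i < r)%N]| = r.
Proof.
by move=> rn; rewrite cardsE -sum1_card (big_ord_narrow rn) sum1_card card_ord.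
Qed.

Lemma card_preim_perm (s : 'S_n) (B : {set 'I_n}) : #|s @^-1: B| = #|B|.
Proof. exact: on_card_preimset (onW_bij _ (injF_bij (@perm_inj _ s))). Qed.

(* G turns the arrangements of a sequence w, seen as functions on indices,
   into monomials or into points. *)
Variable G : {ffun 'I_n -> T} -> V.
Hypothesis injG : injective G.

(** As [c] and [e] differ, an arrangement is determined by the set of places that hold [c]. This
    serves the monomials with equal exponents as well as the orbit of v_k. *)
Lemma undup_arrangements2 (w : nat -> T) r (c e : T) :
  (r <= n)%N -> c != e -> (forall i, w i = if (i < r)%N then c else e) ->
  perm_eq (undup [seq G [ffun i => w (s i)] | s : 'S_n])
    [seq G [ffun i => if i \in B then c else e]
       | B : {set 'I_n} <- enum [set B : {set 'I_n} | #|B| == r]].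
Proof.
move=> rn ce wE; apply: uniq_perm; first exact: undup_uniq.
  rewrite map_inj_uniq ?enum_uniq// => B C /injG /ffunP BC.
  apply/setP => i; have := BC i; rewrite !ffunE.
  by do 2 case: ifP => // _; move=> /eqP; rewrite ?(negbTE ce)// eq_sym (negbTE ce).
move=> v; rewrite mem_undup; apply/codomP/mapP => [[s ->]|[B]].
  exists (s @^-1: [set i : 'I_n | (i < r)%N]).
    by rewrite mem_enum inE card_preim_perm card_ltn_ord.
  by congr G; apply/ffunP => i; rewrite !ffunE wE !inE.
rewrite mem_enum inE => /eqP Br ->; have [s sB] := perm_to_prefix Br.
by exists s; congr G; apply/ffunP => i; rewrite !ffunE wE sB.
Qed.

(** An arrangement is determined by the set [q.1] of places not holding [e] and by the place [q.2]
    of [b] among them. This serves the monomials with one larger exponent, {4} being the case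
    [r = 1], and the orbit of u_{a,p}. *)
Lemma undup_arrangements3 (w : nat -> T) r (b c e : T) :
  (0 < r <= n)%N -> b != c -> b != e -> c != e ->
  (forall i, w i = if i == 0%N then b else if (i < r)%N then c else e) ->
  perm_eq (undup [seq G [ffun i => w (s i)] | s : 'S_n])
    [seq G [ffun i => if i == q.2 then b else if i \in q.1 then c else e]
       | q : {set 'I_n} * 'I_n <-
           enum [pred q : {set 'I_n} * 'I_n | (#|q.1| == r) && (q.2 \in q.1)]].
Proof.
move=> /andP[r0 rn] bc be ce wE; apply: uniq_perm; first exact: undup_uniq.
  rewrite map_inj_in_uniq ?enum_uniq// => -[B i] [C j].
  rewrite !mem_enum !inE /= => /andP[_ iB] /andP[_ jC] /injG /ffunP BC.
  have ij : i = j.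
    have := BC i; rewrite !ffunE eqxx; case: eqVneq => // _.
    by case: ifP => _ /eqP; rewrite ?(negbTE bc) ?(negbTE be).
  rewrite ij in iB BC *; congr (_, _); apply/setP => l.
  have := BC l; rewrite !ffunE; case: eqVneq => [->|_]; first by rewrite iB jC.
  by do 2 case: ifP => // _; move=> /eqP; rewrite ?(negbTE ce)// eq_sym (negbTE ce).
move=> v; rewrite mem_undup; apply/codomP/mapP => [[s ->]|[[B i]]].
  have n0 : (0 < n)%N by exact: leq_trans rn.
  (* The value [b] stands at the place that [s] sends to 0. *)
  exists (s @^-1: [set i : 'I_n | (i < r)%N], s^-1%g (Ordinal n0)).
    by rewrite mem_enum inE /= card_preim_perm card_ltn_ord// !inE permKV eqxx.
  congr G; apply/ffunP => i; rewrite !ffunE wE !inE/=.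
  by rewrite -(inj_eq (@perm_inj _ s)) permKV.
rewrite mem_enum inE /= => /andP[/eqP Br iB] ->.
have [s [sB s0]] := perm_to_pointed_prefix iB Br.
by exists s; congr G; apply/ffunP => j; rewrite !ffunE wE sB s0.
Qed.

End permutation_patterns.

(** * Sums over the subsets of a given size *)

Section subset_sums.
Variables (n : nat) (R : comNzRingType).

(** Meant for [K] the support of v_k: a product over [B] with a factor outside [K] vanishes, and a
    binomial coefficient counts the remaining sets. *)
Lemma sum_subsets (K : {set 'I_n}) r (F : {set 'I_n} -> R) (x : R) :
  (forall B : {set 'I_n}, #|B| = r -> B \subset K -> F B = x) ->
  (forall B : {set 'I_n}, ~~ (B \subset K) -> F B = 0) ->
  \sum_(B : {set 'I_n} | #|B| == r) F B = 'C(#|K|, r)%:R * x.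
Proof.
move=> Fx F0; rewrite (bigID (fun B : {set 'I_n} => B \subset K))/=.
rewrite [X in _ + X]big1 ?addr0; last by move=> B /andP[_ /F0].
rewrite (eq_bigr (fun=> x)); last by move=> B /andP[/eqP Br BK]; exact: Fx.
rewrite sumr_const mulr_natl -cards_draws; congr (_ *+ _).
by apply: eq_card => B; rewrite !inE andbC.
Qed.

(** Meant for u_{a,p}, where [z] carries a and [K] the ones. Sets that contain [z] are counted
    through their other [r] elements, apart from those that avoid it. *)
Lemma sum_subsets_pointed (z : 'I_n) (K : {set 'I_n}) r (F : {set 'I_n} -> R)
    (x y : R) :
  z \notin K ->
  (forall B : {set 'I_n}, #|B| = r.+1 -> B \subset K -> F B = x) ->
  (forall B : {set 'I_n}, #|B| = r -> B \subset K -> F (z |: B) = y) ->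
  (forall B : {set 'I_n}, ~~ (B \subset z |: K) -> F B = 0) ->
  \sum_(B : {set 'I_n} | #|B| == r.+1) F B =
  'C(#|K|, r.+1)%:R * x + 'C(#|K|, r)%:R * y.
Proof.
move=> zK Fx Fy F0; rewrite (bigID (fun B : {set 'I_n} => z \in B))/= addrC.
congr (_ + _).
  (* A set avoiding [z] lies in [z |: K] only if it lies in [K], so cutting [F] off outside [K]
     changes no term of this half. *)
  rewrite -(@sum_subsets K _ (fun B => if B \subset K then F B else 0)).
  - rewrite [RHS](bigID (fun B : {set 'I_n} => z \in B))/= [X in X + _]big1 ?add0r.
      apply: eq_bigr => B /andP[Br zB]; case: ifPn => // BK.
      apply: F0; apply: contra BK => /fintype.subsetP BK; apply/fintype.subsetP => i iB.
      by have := BK i iB; rewrite in_setU1 => /orP[/eqP iz|//]; rewrite -iz iB in zB.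
    move=> B /andP[_ zB]; case: ifPn => // /fintype.subsetP/(_ _ zB).
    by rewrite (negbTE zK).
  - by move=> B Br BK; rewrite BK Fx.
  - by move=> B /negbTE ->.
pose F' (B : {set 'I_n}) := if B \subset K then F (z |: B) else 0.
rewrite -(@sum_subsets K r F'); last 2 first.
- by move=> B Br BK; rewrite /F' BK Fy.
- by move=> B /negbTE; rewrite /F' => ->.
rewrite [RHS](bigID (fun B : {set 'I_n} => z \in B))/= [X in X + _]big1 ?add0r.
  (* Adding [z] is a bijection from the [r]-sets avoiding [z] to the sets of size [r.+1] containing
     it. *)
  rewrite (reindex_onto (fun B => z |: B) (fun B => B :\ z))/=; last first.
    by move=> B /andP[_ zB]; rewrite finset.setD1K.
  apply: eq_big => B.
    have -> : ((z |: B) :\ z == B) = (z \notin B).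
      by apply/eqP/idP => [<-|/finset.setU1K//]; rewrite setD11.
    rewrite setU11 andbT; case: (boolP (z \notin B)) => zB; last by rewrite !andbF.
    by rewrite !andbT cardsU1 zB.
  move=> /andP[/andP[Br _] /eqP zB]; rewrite /F'; case: ifPn => // BK.
  apply: F0; apply: contra BK => /fintype.subsetP BK; apply/fintype.subsetP => i iB.
  have := BK i; rewrite !in_setU1 iB orbT => /(_ isT)/orP[/eqP iz|//].
  by rewrite -zB -iz setD11 in iB.
move=> B /andP[_ zB]; rewrite /F'; case: ifPn => // /fintype.subsetP/(_ _ zB).
by rewrite (negbTE zK).
Qed.

End subset_sums.

(** * Symmetric linear forms in degree 4 *)

Section symmetric_forms.
Context {R : realType}.
Variable d : nat.
Local Notation n := d.+1.
Implicit Types (L : mpoly n R -> R) (y : 'rV[R]_n).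

(** Invariance is asked on monomials only; for a linear [L] this is invariance on all
    polynomials. *)
Definition symmetric_form L := forall (m : multinom n) (s : 'S_n),
  L (mpolyX R (Multinom [tuple m (s i) | i < n])) = L (mpolyX R m).

Definition partition_mnm (l : seq nat) : multinom n :=
  Multinom [tuple nth 0%N l i | i < n].

Definition arrangements (l : seq nat) : seq (multinom n) :=
  undup [seq Multinom [tuple nth 0%N l (s i) | i < n] | s : 'S_n].

Lemma sum_const_seq (I : Type) (r : seq I) (x : R) :
  \sum_(i <- r) x = x *+ size r.
Proof. by rewrite big_const_seq count_predT iter_addr_0. Qed.

Lemma scalar_form_sum L (I : Type) (r : seq I) (c : I -> R) (p : I -> mpoly n R) :
  scalar L -> L (\sum_(i <- r) c i *: p i) = \sum_(i <- r) c i * L (p i).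
Proof.
move=> linL; have L0 : L 0 = 0.
  by have := linL (-1) 0 0; rewrite scaler0 addr0 mulN1r addNr.
elim: r => [|i r IH]; first by rewrite !big_nil.
by rewrite !big_cons linL IH.
Qed.

Lemma form_monomial_symE L l : scalar L ->
  L (monomial_sym d l) = \sum_(m <- arrangements l) L (mpolyX R m).
Proof.
move=> linL; rewrite /monomial_sym.
under eq_bigr do rewrite -[mpolyX R _]scale1r.
rewrite (scalar_form_sum _ _ _ linL).
by apply: eq_bigr => m _; rewrite mul1r.
Qed.

Lemma form_arrangements L l : scalar L -> symmetric_form L ->
  L (monomial_sym d l) = (size (arrangements l))%:R * L (mpolyX R (partition_mnm l)).
Proof.
move=> linL symL; rewrite form_monomial_symE// big_seq.
rewrite (eq_bigr (fun=> L (mpolyX R (partition_mnm l)))).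
  rewrite -big_seq sum_const_seq ?mulr_natl //.
move=> m; rewrite mem_undup => /codomP[s ->].
rewrite -(symL (partition_mnm l) s); congr (L (mpolyX R _)).
by apply/mnmP => i; rewrite !mnmE.
Qed.

Lemma size_arrangements_gt0 l : (0 < size (arrangements l))%N.
Proof.
suff : partition_mnm l \in arrangements l by case: (arrangements l).
rewrite mem_undup; apply/codomP; exists 1%g.
by apply/mnmP => i; rewrite !mnmE perm1.
Qed.

(** The partitions of 4. The sequences are compared through [nth] with default 0, so that trailing
    zeros do not count. *)
Lemma sorted_sum4 (t : seq nat) : sorted geq t -> (3 < size t)%N -> sumn t = 4 ->
  exists2 l : seq nat,
    l \in [:: [:: 4]; [:: 3; 1]; [:: 2; 2]; [:: 2; 1; 1]; [:: 1; 1; 1; 1]]%N &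
    forall i, nth 0%N t i = nth 0%N l i.
Proof.
case: t => [|a [|b [|c [|e t]]]]//= /and4P[ba cb ec et] _ sum4.
(* If the fourth entry is positive, the first four already add up to 4; if it is 0, the later ones
   are 0 by monotonicity. *)
have t0 : sumn t = 0%N.
  have [e0|e0] := posnP e; last by lia.
  move: et; rewrite e0 path_sortedE; last by move=> x y z /=; lia.
  move=> /andP[/allP t0 _]; rewrite sumnE big1_seq// => x /andP[_ /t0] /=; lia.
have nt i : nth 0%N t i = 0%N.
  by have /eqP/natnseq0P -> := t0; rewrite nth_nseq if_same.
have nE l : (size l <= 4)%N -> a = nth 0%N l 0 -> b = nth 0%N l 1 ->
    c = nth 0%N l 2 -> e = nth 0%N l 3 ->
    forall i, nth 0%N [:: a, b, c, e & t] i = nth 0%N l i.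
  move=> l4 -> -> -> -> [|[|[|[|i]]]]//=; rewrite nt nth_default//.
  by rewrite (leq_trans l4).
have : [\/ [/\ a = 4, b = 0, c = 0 & e = 0], [/\ a = 3, b = 1, c = 0 & e = 0],
  [/\ a = 2, b = 2, c = 0 & e = 0] |
  [/\ a = 2, b = 1, c = 1 & e = 0] \/ [/\ a = 1, b = 1, c = 1 & e = 1]]%N.
  case: a b c e ba cb ec {et nE} sum4 => [|[|[|[|[|a]]]]] [|[|[|b]]] [|[|c]] [|[|e]] /=;
    try lia; move=> *; by [constructor 1|constructor 2|constructor 3|
    constructor 4; left|constructor 4; right].
by case=> [[ae be ce ee]|[ae be ce ee]|[ae be ce ee]|[[ae be ce ee]|[ae be ce ee]]];
  [exists [:: 4]%N|exists [:: 3; 1]%N|exists [:: 2; 2]%N|exists [:: 2; 1; 1]%N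
  |exists [:: 1; 1; 1; 1]%N]; rewrite ?inE//; exact: nE.
Qed.

(** Sorting the exponents in decreasing order gives the partition, and the sorting permutation gives
    [s]. *)
Lemma degree4_mnm (m : multinom n) : (3 <= d)%N -> mdeg m = 4 ->
  exists2 l : seq nat,
    l \in [:: [:: 4]; [:: 3; 1]; [:: 2; 2]; [:: 2; 1; 1]; [:: 1; 1; 1; 1]]%N &
    exists s : 'S_n, m = Multinom [tuple partition_mnm l (s i) | i < n].
Proof.
move=> d3 m4; pose t := [tuple of sort geq m].
have pmt : perm_eq m t by rewrite perm_sym perm_sort.
have ts : sorted geq t by apply: sort_sorted => x y; exact: leq_total.
have tsize : (3 < size t)%N by rewrite size_tuple.
have tsum : sumn t = 4 by rewrite -(perm_sumn pmt) -m4 mdegE sumnE big_tuple.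
have [l l5 tl] := sorted_sum4 ts tsize tsum.
exists l => //; have /tuple_permP[s ms] := pmt.
have -> : m = Multinom [tuple tnth t (s i) | i < n] by apply/val_inj/val_inj.
by exists s; apply/mnmP => i; rewrite !mnmE -tl -tnth_nth.
Qed.

(** By symmetry the value of a form at S_l is its value at x^l times the number of monomials of S_l.
    This number is positive and common to both forms, so it cancels, and the forms agree on every
    monomial of degree 4. *)
Lemma degree4_forms_eq L1 L2 : (3 <= d)%N ->
  scalar L1 -> scalar L2 -> symmetric_form L1 -> symmetric_form L2 ->
  (forall l : seq nat,
    l \in [:: [:: 4]; [:: 3; 1]; [:: 2; 2]; [:: 2; 1; 1]; [:: 1; 1; 1; 1]]%N ->
    L1 (monomial_sym d l) = L2 (monomial_sym d l)) ->
  forall f, homogeneous 4 f -> L1 f = L2 f.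
Proof.
move=> d3 lin1 lin2 sym1 sym2 eqL f /allP hf.
rewrite [f]mpolyE !scalar_form_sum// big_seq [RHS]big_seq.
apply: eq_bigr => m /hf/eqP/degree4_mnm[//|l /eqL eql [s ->]]; congr (_ * _).
rewrite sym1 sym2; move: eql; rewrite !form_arrangements//; apply: mulfI.
by rewrite pnatr_eq0 -lt0n size_arrangements_gt0.
Qed.

Lemma poly_eval_scalar y : scalar (fun f : mpoly n R => poly_eval f y).
Proof. by move=> a u v; rewrite /poly_eval mevalD mevalZ. Qed.

Lemma poly_evalX_permute (m : multinom n) (s : 'S_n) y :
  poly_eval (mpolyX R (Multinom [tuple m (s i) | i < n])) y =
  poly_eval (mpolyX R m) (col_perm s^-1%g y).
Proof.
rewrite /poly_eval !mevalX [RHS](reindex_inj (@perm_inj _ s)).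
by apply: eq_bigr => i _; rewrite mnmE mxE permK.
Qed.

Lemma mem_orbit_pts y x : (x \in orbit_pts y) = [exists s : 'S_n, x == col_perm s y].
Proof.
rewrite mem_undup; apply/codomP/existsP => -[s].
  by move=> ->; exists s.
by move=> /eqP ->; exists s.
Qed.

Lemma col_perm_orbit_pts s y :
  perm_eq [seq col_perm s x | x <- orbit_pts y] (orbit_pts y).
Proof.
have cK : cancel (@col_perm R 1 n s) (col_perm s^-1%g).
  by move=> x; rewrite -col_permM mulVg col_perm1.
apply: uniq_perm; last move=> x; rewrite ?(map_inj_uniq (can_inj cK)) ?undup_uniq//.
apply/mapP/idP => [[z]|].
  rewrite !mem_orbit_pts => /existsP[t /eqP ->] ->.
  by apply/existsP; exists (s * t)%g; rewrite col_permM.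
rewrite mem_orbit_pts => /existsP[t /eqP xE].
exists (col_perm (s^-1 * t)%g y); last by rewrite -col_permM mulKVg.
by rewrite mem_orbit_pts; apply/existsP; exists (s^-1 * t)%g.
Qed.

Definition orbit_form y (f : mpoly n R) : R :=
  \sum_(x <- orbit_pts y) poly_eval f x.

Lemma orbit_form_scalar y : scalar (orbit_form y).
Proof.
move=> a u v; rewrite /orbit_form mulr_sumr -big_split.
by apply: eq_bigr => x _; rewrite poly_eval_scalar.
Qed.

Lemma orbit_form_symmetric y : symmetric_form (orbit_form y).
Proof.
move=> m s; rewrite /orbit_form.
rewrite -[RHS](perm_big _ (col_perm_orbit_pts s^-1%g y)) big_map.
by apply: eq_bigr => x _; rewrite poly_evalX_permute.
Qed.

Lemma arrangements_permute l (s : 'S_n) :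
  perm_eq [seq Multinom [tuple m (s i) | i < n] | m : multinom n <- arrangements l]
    (arrangements l).
Proof.
pose h (s : 'S_n) (m : multinom n) := Multinom [tuple m (s i) | i < n].
have hK (t : 'S_n) : cancel (h t) (h t^-1%g).
  by move=> m; apply/mnmP => i; rewrite !mnmE permKV.
apply: uniq_perm; last move=> x; rewrite ?(map_inj_uniq (can_inj (hK s))) ?undup_uniq//.
have memE m : (m \in arrangements l) =
    [exists t : 'S_n, m == Multinom [tuple nth 0%N l (t i) | i < n]].
  rewrite mem_undup; apply/codomP/existsP => -[t]; first by move=> ->; exists t.
  by move=> /eqP ->; exists t.
apply/mapP/idP => [[m]|].
  rewrite !memE => /existsP[t /eqP ->] ->.
  apply/existsP; exists (s * t)%g; apply/eqP/mnmP => i.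
  by rewrite !mnmE permM.
rewrite memE => /existsP[t /eqP xE].
exists (h s^-1%g x); last by apply/mnmP => i; rewrite !mnmE permK.
rewrite memE; apply/existsP; exists (s^-1 * t)%g; apply/eqP/mnmP => i.
by rewrite xE !mnmE permM.
Qed.

Lemma monomial_sym_col_perm l s y :
  poly_eval (monomial_sym d l) (col_perm s y) = poly_eval (monomial_sym d l) y.
Proof.
rewrite !(form_monomial_symE _ (poly_eval_scalar _)).
rewrite -[RHS](perm_big _ (arrangements_permute l s^-1%g)) big_map.
by apply: eq_bigr => m _; rewrite poly_evalX_permute invgK.
Qed.

Lemma orbit_form_monomial_sym l y : orbit_form y (monomial_sym d l) =
  (size (orbit_pts y))%:R * poly_eval (monomial_sym d l) y.
Proof.
rewrite /orbit_form big_seq.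
rewrite (eq_bigr (fun=> poly_eval (monomial_sym d l) y)).
  by rewrite -big_seq sum_const_seq ?mulr_natl.
move=> x; rewrite mem_orbit_pts => /existsP[s /eqP ->].
exact: monomial_sym_col_perm.
Qed.

(** Each monomial is 1 at the point (1, ..., 1). As this point is v_{d+1}, the values of S_l at the
    nodes also count its monomials. *)
Lemma size_arrangements l :
  (size (arrangements l))%:R = poly_eval (monomial_sym d l) (const_mx 1) :> R.
Proof.
rewrite (form_monomial_symE _ (poly_eval_scalar _)).
rewrite (eq_bigr (fun=> 1)) ?sum_const_seq//.
move=> m _; rewrite /poly_eval mevalX big1// => i _.
by rewrite mxE expr1n.
Qed.

End symmetric_forms.

(** * Values of S_l at the nodes, and sizes of their orbits *)

Section node_evaluation.
Context {R : realType}.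
Variable d : nat.
Local Notation n := d.+1.
Implicit Types y : 'rV[R]_n.

Let G (f : {ffun 'I_n -> nat}) : multinom n := Multinom [tuple f i | i < n].

Let injG : injective G.
Proof.
by move=> f g /mnmP fg; apply/ffunP => i; have := fg i; rewrite !mnmE.
Qed.

Let arrangementsE l :
  arrangements d l = undup [seq G [ffun i => nth 0%N l (s i)] | s : 'S_n].
Proof.
congr undup; apply: eq_map => s; apply/mnmP => i.
by rewrite !mnmE ffunE.
Qed.

Lemma poly_eval_monomial_sym_constant l r c y :
  (r <= n)%N -> (0 < c)%N ->
  (forall i, nth 0%N l i = if (i < r)%N then c else 0%N) ->
  poly_eval (monomial_sym d l) y =
  \sum_(B : {set 'I_n} | #|B| == r) \prod_(i in B) y 0 i ^+ c.
Proof.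
move=> rn c0 lE; rewrite (form_monomial_symE _ (poly_eval_scalar _)).
have c0' : c != 0%N by rewrite -lt0n.
rewrite arrangementsE (perm_big _ (undup_arrangements2 injG rn c0' lE))/=.
rewrite big_map big_enum; apply: eq_big => B; first by rewrite inE.
rewrite inE => _; rewrite /poly_eval mevalX [RHS]big_mkcond.
by apply: eq_bigr => i _; rewrite mnmE ffunE; case: ifP.
Qed.

(** A monomial of support [B] with exponent [b.+1] at [i] and 1 elsewhere is x_i^b times the product
    over [B]. Since [b] is positive, [i] can be read off the monomial, and summing over [i] in [B]
    gives the inner sum. *)
Lemma poly_eval_monomial_sym_pointed l r b y :
  (0 < r <= n)%N -> (0 < b)%N ->
  (forall i, nth 0%N l i =
     if i == 0%N then b.+1 else if (i < r)%N then 1 else 0)%N ->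
  poly_eval (monomial_sym d l) y =
  \sum_(B : {set 'I_n} | #|B| == r)
     (\sum_(i in B) y 0 i ^+ b) * \prod_(j in B) y 0 j.
Proof.
move=> rn b0 lE; rewrite (form_monomial_symE _ (poly_eval_scalar _)).
have b1 : b.+1 != 1%N by rewrite eqSS -lt0n.
rewrite arrangementsE.
rewrite (perm_big _ (@undup_arrangements3 _ _ _ _ injG _ r b.+1 1%N 0%N
  rn b1 isT isT lE))/=.
rewrite big_map big_enum.
under [RHS]eq_bigr do rewrite mulr_suml.
rewrite pair_big_dep/=; apply: eq_bigr => -[B i]/= /andP[_ iB].
rewrite /poly_eval mevalX (bigD1 i)//= mnmE ffunE eqxx.
rewrite [in RHS](bigD1 i)//= mulrA -exprSr; congr (_ * _).
rewrite [RHS]big_mkcondl; apply: eq_bigr => j /negbTE ji.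
by rewrite mnmE ffunE ji; case: ifP.
Qed.

Let K k : {set 'I_n} := [set i : 'I_n | (i < k)%N].

Let vptE k i : vpt d k 0 i = (i \in K k)%:R :> R.
Proof. by rewrite mxE inE. Qed.

Lemma poly_eval_vpt_constant l r c k :
  (r <= n)%N -> (0 < c)%N -> (k <= n)%N ->
  (forall i, nth 0%N l i = if (i < r)%N then c else 0%N) ->
  poly_eval (monomial_sym d l) (vpt d k) = 'C(k, r)%:R :> R.
Proof.
move=> rn c0 kn lE; rewrite (poly_eval_monomial_sym_constant _ rn c0 lE).
rewrite (@sum_subsets _ _ (K k) _ _ 1).
- by rewrite card_ltn_ord// mulr1.
- move=> B _ /fintype.subsetP BK; apply: big1 => i /BK iK.
  by rewrite vptE iK expr1n.
- move=> B /fintype.subsetPn[i iB iK]; rewrite (bigD1 i)//= vptE (negbTE iK).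
  by rewrite expr0n gtn_eqF// mul0r.
Qed.

Lemma poly_eval_vpt_pointed l r b k :
  (0 < r <= n)%N -> (0 < b)%N -> (k <= n)%N ->
  (forall i, nth 0%N l i =
     if i == 0%N then b.+1 else if (i < r)%N then 1 else 0)%N ->
  poly_eval (monomial_sym d l) (vpt d k) = 'C(k, r)%:R * r%:R :> R.
Proof.
move=> rn b0 kn lE; rewrite (poly_eval_monomial_sym_pointed _ rn b0 lE).
rewrite (@sum_subsets _ _ (K k) _ _ r%:R).
- by rewrite card_ltn_ord.
- move=> B Br /fintype.subsetP BK; rewrite [X in _ * X]big1 ?mulr1; last first.
    by move=> i /BK iK; rewrite vptE iK.
  rewrite (eq_bigr (fun=> 1)) ?sumr_const ?Br// => i /BK iK.
  by rewrite vptE iK expr1n.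
- move=> B /fintype.subsetPn[i iB iK]; rewrite [X in _ * X](bigD1 i)//= vptE.
  by rewrite (negbTE iK) mul0r mulr0.
Qed.

Let P p : {set 'I_n} := [set i : 'I_n | (0 < i <= p)%N].

Let uptE (a : R) p i :
  upt d a p 0 i = if i == ord0 then a else (i \in P p)%:R.
Proof. by rewrite mxE inE -val_eqE/= lt0n; case: (_ == 0%N). Qed.

Let card_P p : (p <= d)%N -> #|P p| = p.
Proof.
move=> pd; have : K p.+1 = ord0 |: P p.
  apply/setP => i; by rewrite !inE -val_eqE/= ltnS lt0n; case: eqVneq => [->|].
move=> /(congr1 (fun B : {set 'I_n} => #|B|)); rewrite card_ltn_ord//.
by rewrite cardsU1 !inE/= => -[].
Qed.

Let upt_P a p i : i \in P p -> upt d a p 0 i = 1 :> R.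
Proof.
move=> iP; rewrite uptE iP; case: eqVneq => // i0.
by rewrite i0 inE in iP.
Qed.

Let upt_out a p i : i \notin ord0 |: P p -> upt d a p 0 i = 0 :> R.
Proof.
by rewrite in_setU1 negb_or uptE => /andP[/negbTE -> /negbTE ->].
Qed.

Let upt0 a p : upt d a p 0 ord0 = a :> R.
Proof. by rewrite uptE eqxx. Qed.

Let ord0P p : (ord0 : 'I_n) \notin P p. Proof. by rewrite inE. Qed.

(** Here [l] has [r.+1] parts. Supports among the ones contribute 1 each; those through the
    coordinate a contribute a^c. *)
Lemma poly_eval_upt_constant l r c (a : R) p :
  (r < n)%N -> (0 < c)%N -> (p <= d)%N ->
  (forall i, nth 0%N l i = if (i < r.+1)%N then c else 0%N) ->
  poly_eval (monomial_sym d l) (upt d a p) =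
  'C(p, r.+1)%:R + 'C(p, r)%:R * a ^+ c :> R.
Proof.
move=> rn c0 pd lE; rewrite (poly_eval_monomial_sym_constant _ rn c0 lE).
rewrite (@sum_subsets_pointed _ _ ord0 (P p) _ _ 1 (a ^+ c)) ?ord0P//.
- by rewrite card_P// mulr1.
- by move=> B _ /fintype.subsetP BK; apply: big1 => i /BK/upt_P ->; rewrite expr1n.
- move=> B _ /fintype.subsetP BK; rewrite big_setU1/=; last first.
    by apply/negP => /BK; rewrite (negbTE (ord0P p)).
  by rewrite upt0 big1 ?mulr1// => i /BK/upt_P ->; rewrite expr1n.
- move=> B /fintype.subsetPn[i iB iK]; rewrite (bigD1 i)//= upt_out//.
  by rewrite expr0n gtn_eqF// mul0r.
Qed.

(** A support of size [r.+1] among the ones contributes [r.+1], one term for each place of the large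
    exponent. A support through a contributes a^(b+1) when the large exponent falls on a, and a for
    each of the [r] other places. *)
Lemma poly_eval_upt_pointed l r b (a : R) p :
  (r < n)%N -> (0 < b)%N -> (p <= d)%N ->
  (forall i, nth 0%N l i =
     if i == 0%N then b.+1 else if (i < r.+1)%N then 1 else 0)%N ->
  poly_eval (monomial_sym d l) (upt d a p) =
  'C(p, r.+1)%:R * r.+1%:R + 'C(p, r)%:R * ((a ^+ b + r%:R) * a) :> R.
Proof.
move=> rn b0 pd lE.
rewrite (poly_eval_monomial_sym_pointed _ (r := r.+1) rn b0 lE).
rewrite (@sum_subsets_pointed _ _ ord0 (P p) _ _ r.+1%:R
  ((a ^+ b + r%:R) * a)) ?ord0P//.
- by rewrite card_P.
- move=> B Br /fintype.subsetP BK; rewrite [X in _ * X]big1 ?mulr1; last first.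
    by move=> i /BK/upt_P ->.
  rewrite (eq_bigr (fun=> 1)) ?sumr_const ?Br// => i /BK/upt_P ->.
  by rewrite expr1n.
- move=> B Br /fintype.subsetP BK.
  have B0 : ord0 \notin B by apply/negP => /BK; rewrite (negbTE (ord0P p)).
  rewrite !big_setU1//= upt0 [X in a * X]big1 ?mulr1; last first.
    by move=> i /BK/upt_P ->.
  rewrite (eq_bigr (fun=> 1)) ?sumr_const ?Br// => i /BK/upt_P ->.
  by rewrite expr1n.
- move=> B /fintype.subsetPn[i iB iK]; rewrite [X in _ * X](bigD1 i)//= upt_out//.
  by rewrite mul0r mulr0.
Qed.

Let row_of (f : {ffun 'I_n -> R}) : 'rV[R]_n := \row_i f i.

Let row_of_inj : injective row_of.
Proof.
by move=> f g /rowP fg; apply/ffunP => i; have := fg i; rewrite !mxE.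
Qed.

Lemma size_orbit_vpt k : (k <= n)%N ->
  size (orbit_pts (vpt d k : 'rV[R]_n)) = 'C(n, k).
Proof.
move=> kn.
have -> : orbit_pts (vpt d k) =
    undup [seq row_of [ffun i => ((s i < k)%N%:R : R)] | s : 'S_n].
  congr undup; apply: eq_map => s; apply/rowP => i.
  by rewrite !mxE ffunE.
have wE i : (i < k)%N%:R = (if (i < k)%N then 1 else 0) :> R by case: ifP.
rewrite (perm_size (undup_arrangements2 row_of_inj kn (oner_neq0 R) wE)).
by rewrite size_map -cardE -[in RHS](card_ord n) card_draws.
Qed.

(** A point of the orbit is a support of size p + 1 with the place of a marked in it, and (p + 1)
    C(d + 1, p + 1) = (d + 1) C(d, p). *)
Lemma size_orbit_upt (a : R) p : a != 0 -> a != 1 -> (p <= d)%N ->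
  size (orbit_pts (upt d a p)) = (n * 'C(d, p))%N.
Proof.
move=> a0 a1 pd.
have -> : orbit_pts (upt d a p) =
    undup [seq row_of [ffun i => (if s i == 0%N :> nat then a
                                  else (s i <= p)%N%:R)] | s : 'S_n].
  congr undup; apply: eq_map => s; apply/rowP => i.
  by rewrite !mxE ffunE.
have wE i : (if i == 0%N then a else (i <= p)%N%:R) =
    (if i == 0%N then a else if (i < p.+1)%N then 1 else 0) :> R.
  by rewrite ltnS; case: ifP => // _; case: ifP.
rewrite (perm_size (@undup_arrangements3 _ _ _ _ row_of_inj _ p.+1 _ _ _ _
  a1 a0 (oner_neq0 R) wE))//.
rewrite size_map -cardE -sum1_card.
rewrite -(pair_big_dep (fun B : {set 'I_n} => #|B| == p.+1)
  (fun B i => i \in B) (fun _ _ => 1%N)).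
rewrite (eq_bigr (fun=> p.+1)); last by move=> B /eqP <-; rewrite sum1_card.
rewrite sum_nat_const -cardsE -[X in 'C(X, _)]/(n.-1) mul_bin_diag mulnC.
by rewrite card_draws card_ord.
Qed.

End node_evaluation.

Local Open Scope classical_set_scope.
Local Open Scope ring_scope.

(** * Integration over R^n one coordinate at a time *)

Section lebesgue_tuples.
Context {R : realType}.
Local Notation T := (measurableTypeR R).
Local Notation mu := (@lebesgue_measure R).
Local Open Scope ereal_scope.

Lemma integral_leb0 (F : 0.-tuple T -> \bar R) :
  \int[leb 0]_x F x = F [tuple].
Proof.
rewrite /= integral_dirac//; first by rewrite diracT mul1e.
(* R^0 is a single point, so the preimage of [Y] is empty or everything, hence measurable. *)
move=> _ Y mY; rewrite setTI.
have [H|H] := pselect ((F @^-1` Y) [tuple]).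
  suff -> : F @^-1` Y = setT by [].
  by apply/seteqP; split => // x _; rewrite (tuple0 x).
suff -> : F @^-1` Y = set0 by [].
by apply/seteqP; split => // x; rewrite (tuple0 x).
Qed.

(** [leb n.+1] is the image of a product measure: change variables, then apply Tonelli's theorem. *)
Lemma integral_leb_cons n (F : n.+1.-tuple T -> \bar R) :
  measurable_fun [set: n.+1.-tuple T] F -> (forall x, 0 <= F x) ->
  \int[leb n.+1]_x F x =
  \int[mu]_y \int[leb n]_t F (tuple_cons (y, t)).
Proof.
move=> mF F0.
have mc := @measurable_tuple_cons R n.
rewrite -(fubini_tonelli1 (m1 := mu) (m2 := leb n) (F \o @tuple_cons R n))//=.
  rewrite [LHS](_ : _ = \int[pushforward (mu \x leb n) (@tuple_cons R n)]_x F x)//.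
  by rewrite ge0_integral_pushforward.
exact: measurableT_comp.
Qed.

End lebesgue_tuples.

(** * Invariance of Lebesgue measure under permutations of the barycentric coordinates *)

Section permutation_invariance.
Context {R : realType}.
Local Notation T := (measurableTypeR R).
Local Notation mu := (@lebesgue_measure R).

Definition permute_tuple n (s : 'S_n) (z : n.-tuple T) : n.-tuple T :=
  [tuple tnth z (s i) | i < n].

(** For [c = 1] these are the coordinates of [simplex_lift]. An arbitrary total [c] is allowed
    because removing a first coordinate [y] leaves the total [c - y], which the induction on [n] has
    to cover. *)
Definition complete n (c : R) (x : n.-tuple T) : n.+1.-tuple T :=
  [tuple of rcons x (c - \sum_j tnth x j)].

Lemma tnth_complete_max n c (x : n.-tuple T) :
  tnth (complete c x) ord_max = c - \sum_j tnth x j.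
Proof. by rewrite (tnth_nth 0)/= nth_rcons size_tuple ltnn eqxx. Qed.

Lemma tnth_complete_lift n c (x : n.-tuple T) i :
  tnth (complete c x) (lift ord_max i) = tnth x i.
Proof. by rewrite !(tnth_nth 0) lift_max /= nth_rcons size_tuple ltn_ord. Qed.

Lemma sum_complete n c (x : n.-tuple T) : \sum_i tnth (complete c x) i = c.
Proof.
rewrite big_ord_recr/= tnth_complete_max.
rewrite (eq_bigr (tnth x)); first by rewrite subrKC.
move=> i _; rewrite -[RHS](tnth_complete_lift c); congr tnth.
by apply/val_inj; exact/esym/lift_max.
Qed.

Lemma complete_cons n c (y : T) (x : n.-tuple T) :
  complete c (tuple_cons (y, x)) = tuple_cons (y, complete (c - y) x).
Proof.
apply/val_inj => /=; congr (_ :: rcons _ _).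
rewrite big_ord_recl/= (eq_bigr (tnth x)); first by rewrite opprD addrA.
by move=> i _; rewrite !(tnth_nth 0).
Qed.

Lemma permute_tuple_mul n (s t : 'S_n) (z : n.-tuple T) :
  permute_tuple (s * t)%g z = permute_tuple s (permute_tuple t z).
Proof. by apply: eq_from_tnth => i; rewrite !tnth_mktuple permM. Qed.

Lemma permute_tuple1 n (z : n.-tuple T) : permute_tuple 1%g z = z.
Proof. by apply: eq_from_tnth => i; rewrite !tnth_mktuple perm1. Qed.

Lemma tnth_tuple_cons0 n (y : T) (z : n.-tuple T) :
  tnth (tuple_cons (y, z)) ord0 = y.
Proof. by rewrite (tnth_nth 0). Qed.

Lemma tnth_tuple_consS n (y : T) (z : n.-tuple T) i :
  tnth (tuple_cons (y, z)) (lift ord0 i) = tnth z i.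
Proof. by rewrite !(tnth_nth 0). Qed.

Lemma permute_tperm_cons n (i j : 'I_n) (y : T) (z : n.-tuple T) :
  permute_tuple (tperm (lift ord0 i) (lift ord0 j)) (tuple_cons (y, z)) =
  tuple_cons (y, permute_tuple (tperm i j) z).
Proof.
apply: eq_from_tnth => l; rewrite tnth_mktuple.
have [l' ->|->] := unliftP ord0 l; last by rewrite tpermD// !tnth_tuple_cons0.
by rewrite -(inj_tperm _ _ _ lift_inj) !tnth_tuple_consS tnth_mktuple.
Qed.

Lemma permute_tuple01 n (y y' : T) (z : n.-tuple T) :
  permute_tuple (tperm ord0 (lift ord0 ord0))
    (tuple_cons (y, tuple_cons (y', z))) =
  tuple_cons (y', tuple_cons (y, z)).
Proof.
apply: eq_from_tnth => l; rewrite tnth_mktuple.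
have tE := (tnth_tuple_cons0, tnth_tuple_consS).
have [l' ->|->] := unliftP ord0 l; last by rewrite tpermL !tE.
have [l'' ->|->] := unliftP ord0 l'; last by rewrite tpermR !tE.
by rewrite tpermD// !tE.
Qed.

Lemma measurable_fun_tuple_cons d (S : measurableType d) n (f : S -> T)
    (g : S -> n.-tuple T) :
  measurable_fun [set: S] f -> measurable_fun [set: S] g ->
  measurable_fun [set: S] (fun x => tuple_cons (f x, g x)).
Proof. exact: measurable_cons. Qed.

Lemma measurable_permute_tuple n (s : 'S_n) :
  measurable_fun [set: n.-tuple T] (permute_tuple s).
Proof.
apply/measurable_fun_tnthP => i.
rewrite (_ : _ \o _ = fun z : n.-tuple T => tnth z (s i)).
  exact: measurable_tnth.
by apply/funext => z /=; rewrite tnth_mktuple.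
Qed.

Lemma measurable_complete n c :
  measurable_fun [set: n.-tuple T] (complete c).
Proof.
apply/measurable_fun_tnthP => i.
have [j ->|->] := unliftP ord_max i.
  rewrite (_ : _ \o _ = fun z : n.-tuple T => tnth z j).
    exact: measurable_tnth.
  by apply/funext => z /=; rewrite tnth_complete_lift.
rewrite (_ : _ \o _ = fun z : n.-tuple T => (c - \sum_j tnth z j : T)).
  apply: measurable_funB => //.
  apply: measurable_sum => j; exact: measurable_tnth.
by apply/funext => z /=; rewrite tnth_complete_max.
Qed.

Lemma integral_reflect c (f : T -> \bar R) : measurable_fun [set: T] f ->
  (forall x, 0 <= f x)%E ->
  (\int[mu]_x f (c - x)%R = \int[mu]_x f x)%E.
Proof.
move=> mf f0; pose r : T -> T := fun x => (c - x)%R.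
have mr : measurable_fun [set: T] r by exact: measurable_funB.
transitivity (\int[pushforward mu r]_x f x)%E.
  by rewrite (ge0_integral_pushforward mr).
apply: eq_measure_integral => A mA _; apply/esym.
(* It suffices to compare the measures on the intervals ]a, b], whose preimages under the reflection
   are [c - b, c - a[. *)
apply: (@lebesgue_measure_unique R (pushforward mu r)) => // _ [[a b]] _ <-.
transitivity (mu `[(c - b)%R, (c - a)%R[%classic).
  rewrite !lebesgue_measure_itv/= !lte_fin ltrD2l ltrN2 -!EFinB.
  by case: ifP => // _; congr EFin; ring.
congr (mu _); apply/seteqP; split => x /=; rewrite !in_itv/= /r => /andP[]; lra.
Qed.

Local Open Scope ereal_scope.

(** The integral runs over the whole hyperplane of coordinate sum [c], parametrised by [complete c],
    and not just over a simplex. Nonnegative [F] are the ones to which Tonelli's theorem applies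
    directly. *)
Let invariant n c (s : 'S_n.+1) := forall F : n.+1.-tuple T -> \bar R,
  measurable_fun [set: n.+1.-tuple T] F -> (forall z, 0 <= F z) ->
  \int[leb n]_x F (permute_tuple s (complete c x)) =
  \int[leb n]_x F (complete c x).

Let invariant_mul n c (s t : 'S_n.+1) :
  invariant c s -> invariant c t -> invariant c (s * t)%g.
Proof.
move=> Is It F mF F0.
under eq_integral do rewrite permute_tuple_mul.
transitivity (\int[leb n]_x F (permute_tuple s (complete c x))); last exact: Is.
apply: (It (F \o permute_tuple s)) => //=.
by apply: measurableT_comp => //; exact: measurable_permute_tuple.
Qed.

Let mcomplete n c (F : n.+1.-tuple T -> \bar R) :
  measurable_fun [set: n.+1.-tuple T] F ->
  measurable_fun [set: n.-tuple T] (fun x => F (complete c x)).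
Proof. by move=> mF; apply: measurableT_comp => //; exact: measurable_complete. Qed.

Let mpermute n s (F : n.-tuple T -> \bar R) :
  measurable_fun [set: n.-tuple T] F ->
  measurable_fun [set: n.-tuple T] (fun x => F (permute_tuple s x)).
Proof.
by move=> mF; apply: measurableT_comp => //; exact: measurable_permute_tuple.
Qed.

Let mtc n (y : T) : measurable_fun [set: n.-tuple T] (fun z => tuple_cons (y, z)).
Proof. by apply: measurable_fun_tuple_cons. Qed.

(** With the first coordinate [y] held fixed, the inner integral is of the same kind with total
    [c - y]; hence the hypothesis for all totals. *)
Let invariant_lift n c (i j : 'I_n.+1) :
  (forall c, invariant c (tperm i j)) ->
  invariant c (tperm (lift ord0 i) (lift ord0 j)).
Proof.
move=> I F mF F0.
have mF' := mcomplete c mF.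
have mFs := mcomplete c (mpermute (tperm (lift ord0 i) (lift ord0 j)) mF).
rewrite (integral_leb_cons mFs (fun=> F0 _)) (integral_leb_cons mF' (fun=> F0 _)).
apply: eq_integral => y _.
under eq_integral do rewrite complete_cons permute_tperm_cons.
under [RHS]eq_integral do rewrite complete_cons.
apply: (I _ (fun z => F (tuple_cons (y, z)))) => //.
by apply: measurableT_comp => //; exact: mtc.
Qed.

Let invariant01 n c : @invariant n.+1 c (tperm ord0 (lift ord0 ord0)).
Proof.
move=> F mF F0.
case: n F mF F0 => [|n] F mF F0.
  have mF' := mcomplete c mF.
  have mFs := mcomplete c (mpermute (tperm ord0 (lift ord0 ord0)) mF).
  rewrite (integral_leb_cons mFs (fun=> F0 _)) (integral_leb_cons mF' (fun=> F0 _)).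
  under eq_integral do rewrite integral_leb0 complete_cons.
  under [RHS]eq_integral do rewrite integral_leb0 complete_cons.
  (* On the line of points (y, c - y), exchanging the two coordinates is the reflection of [y] into
     [c - y]. *)
  pose pt (y : T) : 2.-tuple T := tuple_cons (y, tuple_cons ((c - y)%R, [tuple])).
  have E y : complete (c - y) ([tuple] : 0.-tuple T) =
      tuple_cons ((c - y)%R, [tuple]).
    by apply/val_inj; rewrite /= big_ord0 subr0.
  under eq_integral do rewrite E permute_tuple01.
  under [RHS]eq_integral do rewrite E.
  rewrite -[RHS](@integral_reflect c (fun y => F (pt y)))//.
    apply: eq_integral => y _; rewrite /pt; congr F.
    by rewrite subKr.
  apply: measurableT_comp => //.
  apply: measurable_fun_tuple_cons => //; apply: measurable_fun_tuple_cons => //.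
  exact: measurable_funB.
have mF' := mcomplete c mF.
have mFs := mcomplete c (mpermute (tperm ord0 (lift ord0 ord0)) mF).
have expand (G : n.+2.-tuple T -> \bar R) : measurable_fun [set: n.+2.-tuple T] G ->
    (forall x, 0 <= G x) ->
    \int[leb n.+2]_x G x =
    \int[mu]_y \int[mu]_z \int[leb n]_t
       G (tuple_cons (y, tuple_cons (z, t))).
  move=> mG G0; rewrite integral_leb_cons//; apply: eq_integral => y _.
  rewrite integral_leb_cons//.
  by apply: measurableT_comp => //; exact: mtc.
rewrite (expand _ mFs (fun=> F0 _)) (expand _ mF' (fun=> F0 _)).
(* [H] integrates out all free variables but the first two. Exchanging the two outer integrals
   exchanges these, and the last coordinate stays the same since it depends on their sum only. *)
pose H (p : T * T) := \int[leb n]_t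
  F (complete c (tuple_cons (p.1, tuple_cons (p.2, t)))).
have mH : measurable_fun [set: T * T] H.
  apply: (measurable_fun_fubini_tonelli_F (m2 := leb n)
    (fun q : (T * T) * n.-tuple T =>
      F (complete c (tuple_cons (q.1.1, tuple_cons (q.1.2, q.2))))))%E => //.
  apply: measurableT_comp => //.
  apply: (measurableT_comp (@measurable_complete n.+2 c)).
  apply: (measurable_fun_tuple_cons (f := fst \o fst)).
    exact: measurableT_comp.
  apply: (measurable_fun_tuple_cons (f := snd \o fst)) => //.
  exact: measurableT_comp.
have H0 p : 0 <= H p by apply: integral_ge0 => t _; exact: F0.
rewrite [RHS](fubini_tonelli (m1 := mu) (m2 := mu) H mH H0).
apply: eq_integral => y _; apply: eq_integral => z _.
apply: eq_integral => t _; congr F.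
rewrite !complete_cons permute_tuple01.
by rewrite [(c - y - z)%R]addrAC.
Qed.

(* Transpositions fixing the first coordinate come from the induction hypothesis
   under the outer integral, the transposition of the first two from Tonelli's
   theorem (a reflection when n = 1), and the others by conjugation. *)
Let invariant_tperm n c (i j : 'I_n.+1) : invariant c (tperm i j).
Proof.
elim: n c i j => [|n IH] c i j.
  by rewrite (ord1 i) (ord1 j) tperm1 => F mF F0;
    under eq_integral do rewrite permute_tuple1.
have I0 (k : 'I_n.+2) : invariant c (tperm ord0 k).
  have [k' ->|->] := unliftP ord0 k; last first.
    by rewrite tperm1 => F mF F0; under eq_integral do rewrite permute_tuple1.
  have [->|k'0] := eqVneq k' (ord0 : 'I_n.+1); first exact: invariant01.
  have -> : tperm ord0 (lift ord0 k') =
      (tperm ord0 (lift ord0 ord0) ^ tperm (lift ord0 ord0) (lift ord0 k'))%g.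
    by rewrite tpermJ tpermL tpermD.
  rewrite conjgE tpermV; apply: invariant_mul; first exact: invariant_lift.
  apply: invariant_mul; [exact: invariant01|exact: invariant_lift].
have [i' ->|->] := unliftP ord0 i; last exact: I0.
have [j' ->|->] := unliftP ord0 j; last by rewrite tpermC; exact: I0.
exact: invariant_lift.
Qed.

(** Transpositions generate the symmetric group, and invariance passes to products. *)
Lemma ge0_integral_permute n c (s : 'S_n.+1) (F : n.+1.-tuple T -> \bar R) :
  measurable_fun [set: n.+1.-tuple T] F -> (forall z, 0 <= F z) ->
  \int[leb n]_x F (permute_tuple s (complete c x)) =
  \int[leb n]_x F (complete c x).
Proof.
move: F; rewrite -/(invariant c s).
have [ts -> _] := prod_tpermP s.
apply: (@big_ind _ (invariant c)).
- by move=> F mF F0; under eq_integral do rewrite permute_tuple1.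
- exact: invariant_mul.
- by move=> ? _; exact: invariant_tperm.
Qed.

Lemma integral_permute n c (s : 'S_n.+1) (F : n.+1.-tuple T -> \bar R) :
  measurable_fun [set: n.+1.-tuple T] F ->
  \int[leb n]_x F (permute_tuple s (complete c x)) =
  \int[leb n]_x F (complete c x).
Proof.
move=> mF; rewrite integralE [RHS]integralE.
rewrite (funepos_comp F (complete c)) (funeneg_comp F (complete c)).
rewrite (funepos_comp F (permute_tuple s \o complete c)).
rewrite (funeneg_comp F (permute_tuple s \o complete c)).
by congr (_ - _); apply: ge0_integral_permute => //;
  [exact: measurable_funepos|exact: measurable_funeneg].
Qed.

End permutation_invariance.

(** * Integrals of products and of powers *)

Section product_integrals.
Context {R : realType}.
Local Notation T := (measurableTypeR R).
Local Notation mu := (@lebesgue_measure R).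

Lemma measurable_prod_tnth n (h : 'I_n -> T -> R) :
  (forall i, measurable_fun [set: T] (h i)) ->
  measurable_fun [set: n.-tuple T] (fun x => \prod_i h i (tnth x i)).
Proof.
move=> mh; apply: measurable_prod => i _.
by apply: measurableT_comp => //; exact: measurable_tnth.
Qed.

Lemma integral_leb_prod n (h : 'I_n -> T -> R) (c : 'I_n -> R) :
  (forall i, measurable_fun [set: T] (h i)) -> (forall i x, 0 <= h i x) ->
  (forall i, \int[mu]_x (h i x)%:E = (c i)%:E)%E ->
  (\int[leb n]_x (\prod_i h i (tnth x i))%:E = (\prod_i c i)%:E)%E.
Proof.
elim: n h c => [|n IH] h c mh h0 hc; first by rewrite integral_leb0 !big_ord0.
have mP := measurable_prod_tnth mh.
have mE : measurable_fun [set: n.+1.-tuple T]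
  (fun x => (\prod_i h i (tnth x i))%:E) by exact/measurable_EFinP.
rewrite (integral_leb_cons mE); last first.
  by move=> x; rewrite lee_fin; apply: prodr_ge0.
pose h' i := h (lift ord0 i).
have mP' := measurable_prod_tnth (fun i => mh (lift ord0 i)).
transitivity (\int[mu]_y ((h ord0 y)%:E * (\prod_i c (lift ord0 i))%:E))%E.
  apply: eq_integral => y _.
  rewrite -(IH h' (fun i => c (lift ord0 i)) (fun i => mh _) (fun i => h0 _)
    (fun i => hc _)).
  rewrite -ge0_integralZl_EFin//; last 2 first.
  - by move=> x _; rewrite lee_fin; apply: prodr_ge0 => i _; exact: h0.
  - exact/measurable_EFinP.
  apply: eq_integral => x _; rewrite big_ord_recl EFinM tnth_tuple_cons0.
  by congr (_ * EFin _)%E; apply: eq_bigr => i _; rewrite tnth_tuple_consS.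
have mh0 : measurable_fun [set: T] (fun y => (h ord0 y)%:E).
  exact/measurable_EFinP.
have c0 : (0 <= (\prod_i c (lift ord0 i))%:E)%E.
  rewrite lee_fin; apply: prodr_ge0 => i _.
  by rewrite -lee_fin -hc; apply: integral_ge0 => x _; rewrite lee_fin.
rewrite (@ge0_integralZr _ _ _ mu _ measurableT _ mh0 _ (fun x _ => h0 _ x) c0).
by rewrite hc big_ord_recl.
Qed.

(** Remove the point 0 and exhaust ]0, 1] by the intervals [1 / (n + 1), 1]. There x^g has the
    primitive x^(g+1) / (g+1), so each integral is at most 1 / (g + 1), and monotone convergence
    carries the bound to the limit. *)
Lemma integral_powR_lty (g : R) : -1 < g ->
  (\int[mu]_(x in `[0%R, 1%R]) (x `^ g)%:E < +oo)%E.
Proof.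
move=> g1; have g0 : 0 < g + 1 by lra.
have mpow : measurable_fun [set: T] (fun x : T => (x `^ g)%:E).
  by apply/measurable_EFinP; exact: measurable_powR.
rewrite -integral_itv_obnd_cbnd; last exact: measurable_funTS mpow.
pose F n : set T := `[n.+1%:R^-1, 1%R]%classic.
have -> : `]0, 1]%classic = \bigcup_n F n.
  apply/seteqP; split => x /=.
    rewrite in_itv/= => /andP[x0 x1].
    exists (Num.truncn x^-1) => //=; rewrite /F/= in_itv/= x1 andbT.
    by rewrite invf_ple ?posrE// ltW// truncnS_gt.
  move=> [n _]; rewrite /F/= !in_itv/= => /andP[nx ->]; rewrite andbT.
  by rewrite (lt_le_trans _ nx)// invr_gt0.
have ndF : nondecreasing_seq F.
  move=> m n mn; apply/subsetPset => x; rewrite /F/= !in_itv/= => /andP[mx ->].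
  by rewrite andbT (le_trans _ mx)// lef_pV2 ?posrE// ler_nat.
have pow0 n x : F n x -> (0 <= (x `^ g)%:E)%E by rewrite lee_fin powR_ge0.
have cvgF := @ge0_nondecreasing_set_cvg_integral _ _ _ F _ mu ndF
  (fun=> measurable_itv _) (fun=> measurable_funTS mpow) pow0.
apply: (@le_lt_trans _ _ (((g + 1)^-1)%:E)); last exact: ltry.
have -> := esym (cvg_lim _ cvgF); last exact: ereal_hausdorff.
apply: lime_le; first by apply/cvg_ex; eexists; exact: cvgF.
apply: nearW => n.
have n0 : (0 < n.+1%:R^-1 :> R) by rewrite invr_gt0.
have pos (x : R) : n.+1%:R^-1 <= x -> 0 < x by exact: lt_le_trans.
have := ler_nat R 1 n.+1; rewrite ltnS leq0n => n1.
have : (n.+1%:R^-1 <= 1 :> R) by rewrite invf_le1.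
(* The first interval is the single point 1; the fundamental theorem of calculus is applied to the
   nondegenerate ones. *)
rewrite le_eqVlt => /predU1P[e1|lt1].
  by rewrite /F e1 set_itv1 integral_set1 lee_fin invr_ge0 ltW.
pose P (x : R) : R := (g + 1)^-1 * x `^ (g + 1).
have dP (x : R) : 0 < x -> is_derive x 1 P (x `^ g).
  move=> x0; have := is_derive1_powR (g + 1) x0.
  rewrite addrK => H.
  have := is_deriveZ (g + 1)^-1 H.
  by rewrite scalerA mulVf ?gt_eqF// scale1r.
rewrite /F (@continuous_FTC2 _ (fun x : R => x `^ g) P)//.
- rewrite -EFinB lee_fin /P powR1 mulr1 gerBl mulr_ge0 ?powR_ge0//.
  by rewrite invr_ge0 ltW.
- apply: derivable_within_continuous => x; rewrite in_itv/= => /andP[/pos x0 _].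
  by apply: derivable_powR; rewrite in_itv/= x0.
- have cP (x : R) : 0 < x -> {for x, continuous P}.
    by move=> /dP [dx _]; apply: differentiable_continuous; apply/derivable1_diffP.
  split.
  + by move=> x; rewrite in_itv/= => /andP[/ltW/pos/dP[]].
  + by apply: cvg_at_right_filter; exact: cP.
  + by apply: cvg_at_left_filter; exact: cP.
- move=> x; rewrite in_itv/= => /andP[/ltW/pos/dP H _].
  by rewrite derive1E derive_val.
Qed.

End product_integrals.

(** * The weight: finite integral, and positivity *)

Section simplex_weight.
Context {R : realType}.
Local Notation T := (measurableTypeR R).
Local Notation mu := (@lebesgue_measure R).
Variable g : R.

(** The indicators restrict to the nonnegative orthant, so that integrals over the simplex become
    integrals over R^d of a function symmetric in all d + 1 coordinates. *)
Definition weight n (z : n.-tuple T) : R :=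
  \prod_i (tnth z i `^ g * \1_(`[0, +oo[%classic) (tnth z i)).

Lemma indic_itvcyE (c x : R) : \1_(`[c, +oo[%classic) x = (c <= x)%R%:R :> R.
Proof. by rewrite indicE mem_setE in_itv/= andbT. Qed.

Lemma weight_ge0 n (z : n.-tuple T) : 0 <= weight z.
Proof. by apply: prodr_ge0 => i _; rewrite mulr_ge0 ?powR_ge0// indic_itvcyE. Qed.

Lemma weight_pos n (z : n.-tuple T) : (forall i, 0 <= tnth z i) ->
  weight z = (\prod_i tnth z i) `^ g.
Proof.
move=> z0; have -> : weight z = \prod_i (tnth z i `^ g).
  by apply: eq_bigr => i _; rewrite indic_itvcyE z0 mulr1.
suff [] : \prod_i tnth z i `^ g = (\prod_i tnth z i) `^ g /\
          0 <= \prod_i tnth z i by [].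
apply: (big_ind2 (fun x y : R => x = y `^ g /\ 0 <= y)).
- by rewrite powR1.
- by move=> x1 x2 y1 y2 [-> x20] [-> y20]; rewrite powRM ?mulr_ge0.
- by move=> i _.
Qed.

Lemma weight_eq0 n (z : n.-tuple T) i : tnth z i < 0 -> weight z = 0.
Proof.
by move=> zi; rewrite /weight (bigD1 i)//= indic_itvcyE leNgt zi/= mulr0 mul0r.
Qed.

Lemma weight_permute n s (z : n.-tuple T) : weight (permute_tuple s z) = weight z.
Proof.
rewrite /weight [RHS](reindex_inj (@perm_inj _ s)).
by apply: eq_bigr => i _; rewrite tnth_mktuple.
Qed.

Lemma measurable_weight n : measurable_fun [set: n.-tuple T] (@weight n).
Proof.
apply: (measurable_prod_tnth (h := fun _ x => x `^ g * \1_(`[0, +oo[%classic) x)) => i.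
by apply: measurable_funM => //; exact: measurable_indic.
Qed.

(** For x in ]0, 1] the power decreases with the exponent, and g lies between -|g| and |g|. Both
    signs of [g] are thus treated at once. *)
Lemma powR_le_abs (q x : R) : 0 < q -> q <= x -> x <= 1 ->
  q `^ `|g| <= x `^ g <= (q `^ `|g|)^-1.
Proof.
move=> q0 qx x1; have x0 : 0 < x by exact: lt_le_trans qx.
have x01 : 0 < x <= 1 by rewrite x0.
have qx' : q `^ `|g| <= x `^ `|g| by rewrite ge0_ler_powR ?nnegrE// ltW.
apply/andP; split; first by rewrite (le_trans qx')// ger_powR// ler_norm.
apply: (@le_trans _ _ (x `^ (- `|g|))); first last.
  by rewrite powRN lef_pV2// posrE powR_gt0.
by rewrite ger_powR// lerNl -normrN ler_norm.
Qed.

(* Some barycentric coordinate is at least [q = 1 / (n + 1)]. By symmetry it can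
   be taken to be the last one; its factor is then bounded, and the other
   factors are dominated by a product of integrable functions. *)
Lemma integral_weight_lty n : -1 < g ->
  (\int[leb n]_x (weight (complete 1 x))%:E < +oo)%E.
Proof.
move=> g1; pose q : R := n.+1%:R^-1.
have q0 : 0 < q by rewrite invr_gt0.
pose k i (z : n.+1.-tuple T) : R := weight z * \1_(`[q, +oo[%classic) (tnth z i).
have k0 i z : 0 <= k i z by rewrite mulr_ge0 ?weight_ge0.
have mk i : measurable_fun [set: n.+1.-tuple T] (k i).
  apply: measurable_funM; first exact: measurable_weight.
  apply: measurableT_comp; [exact: measurable_indic|exact: measurable_tnth].
have mkc i : measurable_fun [set: n.-tuple T] (fun x => (k i (complete 1 x))%:E).
  apply/measurable_EFinP; apply: measurableT_comp => //.
  exact: measurable_complete.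
have mw : measurable_fun [set: n.-tuple T] (fun x => (weight (complete 1 x))%:E).
  apply/measurable_EFinP; apply: measurableT_comp; first exact: measurable_weight.
  exact: measurable_complete.
have kc0 i x : (0 <= (k i (complete 1 x))%:E)%E by rewrite lee_fin.
have wle (x : n.-tuple T) :
    ((weight (complete 1 x))%:E <= \sum_(i <- enum 'I_n.+1) (k i (complete 1 x))%:E)%E.
  rewrite sumEFin lee_fin big_enum/=.
  have [i qi] : exists i, q <= tnth (complete 1 x) i.
    apply: contrapT => /forallNP H.
    have : \sum_i tnth (complete 1 x) i < \sum_(i < n.+1) q.
      apply: ltr_sum => [|i _]; last by rewrite ltNge; exact/negP/H.
      by apply/hasP; exists ord0; rewrite ?mem_index_enum.
    by rewrite sum_complete sumr_const card_ord -mulr_natr mulVf ?ltxx.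
  rewrite (bigD1 i)//= /k indic_itvcyE qi mulr1 lerDl.
  by apply: sumr_ge0 => j _; exact: k0.
apply: (@le_lt_trans _ _
    (\int[leb n]_x \sum_(i <- enum 'I_n.+1) (k i (complete 1 x))%:E)%E).
  apply: ge0_le_integral => //.
  - by move=> x _; rewrite lee_fin weight_ge0.
  - exact: emeasurable_sum.
rewrite ge0_integral_sum//; apply: lte_sum_pinfty => i _.
have -> : (\int[leb n]_x (k i (complete 1 x))%:E =
           \int[leb n]_x (k ord_max (complete 1 x))%:E)%E.
  rewrite -[RHS](integral_permute 1 (tperm i ord_max) (F := EFin \o k ord_max)).
    apply: eq_integral => x _ /=.
    by rewrite /k weight_permute tnth_mktuple tpermR.
  exact/measurable_EFinP.
pose C : R := (q `^ `|g|)^-1.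
have C0 : 0 <= C by rewrite invr_ge0 powR_ge0.
pose h (x : T) : R := x `^ g * \1_(`[0, 1]%classic) x.
have mh : measurable_fun [set: T] h.
  by apply: measurable_funM => //; exact: measurable_indic.
have h0 x : 0 <= h x by rewrite mulr_ge0 ?powR_ge0.
have [c hc] : exists c, (\int[mu]_x (h x)%:E = c%:E)%E.
  have : (\int[mu]_x (h x)%:E < +oo)%E.
    apply: le_lt_trans (integral_powR_lty g1).
    rewrite [leRHS]integral_mkcond; apply: ge0_le_integral => //.
    - by move=> x _; rewrite lee_fin.
    - exact/measurable_EFinP.
    - by apply/(measurable_restrictT _ _).1 => //;
        apply: measurable_funTS; apply/measurable_EFinP; exact: measurable_powR.
    - move=> x _; rewrite /h indicE patchE; case: ifP => _; last by rewrite mulr0.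
      by rewrite mulr1.
  case E : (\int[mu]_x (h x)%:E)%E => [r| |]//; first by exists r.
  have := @integral_ge0 _ _ _ mu setT (fun x => (h x)%:E) (fun x _ => h0 x).
  by rewrite E.
have hP := @integral_leb_prod R n (fun=> h) (fun=> c) (fun=> mh) (fun=> h0) (fun=> hc).
have mP := @measurable_prod_tnth R n (fun=> h) (fun=> mh).
apply: (@le_lt_trans _ _ (\int[leb n]_x (C%:E * (\prod_i h (tnth x i))%:E))%E); last first.
  rewrite ge0_integralZl_EFin//; last 2 first.
  - by move=> x _; rewrite lee_fin prodr_ge0.
  - exact/measurable_EFinP.
  by rewrite hP -EFinM ltry.
apply: ge0_le_integral => //.
- by apply/measurable_EFinP; apply: measurable_funM.
- move=> x _; rewrite -EFinM lee_fin.
  have [z0|] := pselect (forall i, 0 <= tnth (complete 1 x) i); last first.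
    move=> /existsNP[j /negP]; rewrite -ltNge => zj.
    by rewrite /k (weight_eq0 zj) mul0r mulr_ge0// prodr_ge0.
  rewrite /k indic_itvcyE.
  have [qz|_] := leP q; last by rewrite mulr0 mulr_ge0// prodr_ge0.
  have z1 j : tnth (complete 1 x) j <= 1.
    rewrite -[leRHS](sum_complete 1 x) (bigD1 j)//= lerDl.
    by apply: sumr_ge0 => i' _; exact: z0.
  rewrite mulr1 /weight big_ord_recr/= mulrC ler_pM//.
  + by rewrite mulr_ge0 ?powR_ge0.
  + by apply: prodr_ge0 => j _; rewrite mulr_ge0 ?powR_ge0.
  + rewrite indic_itvcyE z0 mulr1.
    by have /andP[] := powR_le_abs q0 qz (z1 _).
  + apply: ler_prod => j _; rewrite mulr_ge0 ?powR_ge0//=.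
    have -> : widen_ord (leqnSn n) j = lift ord_max j.
      by apply/val_inj; exact/esym/lift_max.
    have := z0 (lift ord_max j); have := z1 (lift ord_max j).
    rewrite tnth_complete_lift /h => z1j z0j.
    by rewrite indic_itvcyE z0j indicE mem_setE in_itv/= z0j z1j.
Qed.

Lemma integral_sqr_diff_gt0 n :
  (0 < \int[leb n.+2]_x
    (let z := complete 1 x in
     tnth z ord0 * tnth z (lift ord0 ord0) *
     (tnth z ord0 - tnth z (lift ord0 ord0)) ^+ 2 * weight z)%:E)%E.
Proof.
(* The integrand is bounded below on the box [3e, 4e] x [e, 2e] x ... x [e, 2e],
   which lies in the interior of the simplex. *)
pose e : R := (4 * n.+3%:R)^-1.
have n3 : 1 <= n.+3%:R :> R by rewrite ler1n.
have e0 : 0 < e by rewrite invr_gt0; lra.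
have eE : n.+3%:R * e * 4 = 1 by rewrite /e; field; rewrite gt_eqF//; lra.
have e4 : 4 * e <= 1 by nra.
pose h (i : 'I_n.+2) (x : T) : R :=
  if i == ord0 then \1_(`[3 * e, 4 * e]%classic) x else \1_(`[e, 2 * e]%classic) x.
have mh i : measurable_fun [set: T] (h i).
  by rewrite /h; case: (i == ord0); exact: measurable_indic.
have h0 i x : 0 <= h i x by rewrite /h; case: ifP.
have hc i : (\int[mu]_x (h i x)%:E = e%:E)%E.
  have itv (b c : R) : b < c ->
      (\int[mu]_x (\1_(`[b, c]%classic) x)%:E = (c - b)%:E)%E.
    move=> bc; rewrite (@integral_indic _ _ _ mu _ measurableT) ?setIT//.
    transitivity (mu `[b, c]%classic) => //.
    by rewrite lebesgue_measure_itv/= lte_fin bc -EFinB.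
  have e34 : 3 * e < 4 * e by lra.
  have e12 : e < 2 * e by lra.
  by rewrite /h; case: (i == ord0); rewrite itv //; congr EFin; ring.
have hP := @integral_leb_prod R n.+2 h (fun=> e) mh h0 hc.
have mP := @measurable_prod_tnth R n.+2 h mh.
(* On the box the first two coordinates are at least [e] and differ by at least 3e - 2e = e, which
   gives [e ^+ 4]. The other factor bounds the weight, one power for each of the n + 3
   coordinates. *)
pose D : R := e ^+ 4 * (e `^ `|g|) ^+ n.+3.
have D0 : 0 < D by rewrite mulr_gt0// exprn_gt0// powR_gt0.
apply: (@lt_le_trans _ _ (\int[leb n.+2]_x (D%:E * (\prod_i h i (tnth x i))%:E))%E).
  rewrite ge0_integralZl_EFin//; last 3 first.
  - by move=> x _; rewrite lee_fin prodr_ge0.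
  - exact/measurable_EFinP.
  - exact: ltW.
  by rewrite hP -EFinM lte_fin mulr_gt0// prodr_gt0.
apply: ge0_le_integral => //.
- by move=> x _; rewrite lee_fin mulr_ge0 ?(ltW D0)// prodr_ge0.
- by apply/measurable_EFinP; apply: measurable_funM.
- apply/measurable_EFinP.
  pose F (z : n.+3.-tuple T) : R := tnth z ord0 * tnth z (lift ord0 ord0) *
     (tnth z ord0 - tnth z (lift ord0 ord0)) ^+ 2 * weight z.
  apply: (@measurableT_comp _ _ _ _ _ _ F); last exact: measurable_complete.
  have mt := @measurable_tnth _ T n.+3.
  apply: measurable_funM; last exact: measurable_weight.
  apply: measurable_funM; first by apply: measurable_funM; exact: mt.
  by apply: measurable_funX; apply: measurable_funB; exact: mt.
- move=> x _; rewrite -EFinM lee_fin /=.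
  set z := complete 1 x.
  have [b|] := pselect (forall i, if i == ord0 then 3 * e <= tnth x i <= 4 * e
    else e <= tnth x i <= 2 * e); last first.
    move=> /existsNP[i Hi].
    have -> : \prod_i h i (tnth x i) = 0.
      rewrite (bigD1 i)//=; rewrite /h; case: ifP Hi => _ /negP/negbTE Hi;
      by rewrite indicE mem_setE in_itv/= Hi mul0r.
    rewrite mulr0.
    have [z0|] := pselect (forall i, 0 <= tnth z i); last first.
      move=> /existsNP[j /negP]; rewrite -ltNge => zj.
      by rewrite (weight_eq0 zj) mulr0.
    by rewrite mulr_ge0 ?weight_ge0// mulr_ge0 ?sqr_ge0// mulr_ge0.
  have -> : \prod_i h i (tnth x i) = 1.
    apply: big1 => i _; have := b i; rewrite /h; case: ifP => _ Hi;
    by rewrite indicE mem_setE in_itv/= Hi.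
  rewrite mulr1.
  have zx i : tnth z (lift ord_max i) = tnth x i by exact: tnth_complete_lift.
  have xlo i : e <= tnth x i.
    by have := b i; case: ifP => _ /andP[]//; lra.
  have xhi i : tnth x i <= 4 * e by have := b i; case: ifP => _ /andP[]//; lra.
  (* The free coordinates add up to at most 4e + 2(n + 1)e = 2(n + 3)e = 1/2, so at least 1/2 is
     left for the last one. *)
  have zmax : e <= tnth z ord_max.
    rewrite /z tnth_complete_max.
    have : \sum_i tnth x i <= 4 * e + \sum_(i < n.+1) 2 * e.
      rewrite big_ord_recl lerD// ler_sum// => i _.
      by have := b (lift ord0 i); rewrite /= => /andP[].
    rewrite sumr_const card_ord -(mulr_natr (2 * e) n.+1).
    have -> : (n.+1%:R : R) = n.+3%:R - 2 by rewrite -natrB// subn2.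
    nra.
  have zlo i : e <= tnth z i.
    by have [j ->|->] := unliftP ord_max i; rewrite ?zx.
  have zhi i : tnth z i <= 1.
    rewrite -[leRHS](sum_complete 1 x) (bigD1 i)//= lerDl.
    by apply: sumr_ge0 => j _; rewrite (le_trans _ (zlo j))// ltW.
  have z0E : tnth z ord0 = tnth x ord0.
    by rewrite -zx; congr (tnth z _); apply/val_inj.
  have z1E : tnth z (lift ord0 ord0) = tnth x (lift ord0 ord0).
    by rewrite -zx; congr (tnth z _); apply/val_inj.
  apply: ler_pM; rewrite ?exprn_ge0 ?powR_ge0 ?(ltW e0)//.
    rewrite z0E z1E; have := b ord0; have := b (lift ord0 ord0); rewrite /=.
    set u := tnth x _; set v := tnth x _ => /andP[u1 u2] /andP[v1 v2].
    have -> : e ^+ 4 = (e * e) * (e * e) by ring.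
    have ee : 0 <= e * e by rewrite mulr_ge0 ?ltW.
    have uv : e * e <= v * u by nra.
    have uv2 : e * e <= (v - u) ^+ 2 by nra.
    exact: ler_pM.
  rewrite -[X in _ ^+ X]card_ord -prodr_const; apply: ler_prod => i _.
  rewrite powR_ge0/= indic_itvcyE (le_trans (ltW e0) (zlo i)) mulr1.
  by have /andP[] := powR_le_abs e0 (zlo i) (zhi i).
Qed.

End simplex_weight.

(** * The mean over the simplex as a symmetric linear form *)

Section simplex_functional.
Context {R : realType}.
Local Notation T := (measurableTypeR R).
Variables (d : nat) (g : R).
Hypothesis g1 : -1 < g.

(** Outside the solid simplex some coordinate of [complete 1 x] is negative and the weight vanishes,
    so the domain of integration is absorbed in the weight. *)
Lemma simplex_integralE (f : 'rV[R]_d.+1 -> R) :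
  simplex_integral g f =
  \int[leb d]_x (f (simplex_lift x) * weight g (complete 1 x)).
Proof.
rewrite /simplex_integral Rintegral_mkcond; apply: eq_Rintegral => x _.
have lift0 i : simplex_lift x 0 i = tnth (complete 1 x) i by rewrite mxE.
rewrite patchE; case: ifPn => [/set_mem[x0 x1]|/negP xNS].
  rewrite weight_pos; last first.
    move=> i; have [j ->|->] := unliftP ord_max i.
      by rewrite tnth_complete_lift.
    by rewrite tnth_complete_max subr_ge0.
  by congr (_ * _ `^ _); apply: eq_bigr => i _; rewrite lift0.
have [z0|] := pselect (forall i, 0 <= tnth (complete 1 x) i); last first.
  by move=> /existsNP[i /negP]; rewrite -ltNge => /(weight_eq0 g) ->; rewrite mulr0.
case: xNS; apply/mem_set; split => [i|].
  by rewrite -(tnth_complete_lift 1).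
by have := z0 ord_max; rewrite tnth_complete_max subr_ge0.
Qed.

Lemma poly_evalE (f : mpoly d.+1 R) (y : 'rV[R]_d.+1) :
  poly_eval f y = \sum_(m <- msupp f) mcoeff m f * \prod_i y 0 i ^+ m i.
Proof. exact: mevalE. Qed.

Lemma poly_evalX m (y : 'rV[R]_d.+1) :
  poly_eval (mpolyX R m) y = \prod_i y 0 i ^+ m i.
Proof. exact: mevalX. Qed.

Lemma measurable_poly_eval (f : mpoly d.+1 R) :
  measurable_fun [set: d.+1.-tuple T]
    (fun z => poly_eval f (\row_i tnth z i)).
Proof.
under eq_fun do rewrite poly_evalE.
apply: measurable_sum => m; apply: measurable_funM => //.
apply: measurable_prod => i _; apply: measurable_funX.
under eq_fun do rewrite mxE.
exact: measurable_tnth.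
Qed.

Lemma measurable_poly_weight (f : mpoly d.+1 R) :
  measurable_fun [set: d.-tuple T]
    (fun x => poly_eval f (simplex_lift x) * weight g (complete 1 x)).
Proof.
apply: (@measurableT_comp _ _ _ _ _ _
  (fun z : d.+1.-tuple T => poly_eval f (\row_i tnth z i) * weight g z)).
  apply: measurable_funM; first exact: measurable_poly_eval.
  exact: measurable_weight.
exact: measurable_complete.
Qed.

(** On the simplex the coordinates lie in [0, 1], so a monomial is at most 1; elsewhere both sides
    are 0. Integrability follows by domination. *)
Lemma poly_weight_le (f : mpoly d.+1 R) (x : d.-tuple T) :
  `|poly_eval f (simplex_lift x) * weight g (complete 1 x)| <=
  (\sum_(m <- msupp f) `|mcoeff m f|) * weight g (complete 1 x).
Proof.
rewrite normrM [`|weight _ _|]ger0_norm ?weight_ge0//.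
have [z0|] := pselect (forall i, 0 <= tnth (complete 1 x) i); last first.
  by move=> /existsNP[i /negP]; rewrite -ltNge => /(weight_eq0 g) ->; rewrite !mulr0.
have z1 j : tnth (complete 1 x) j <= 1.
  rewrite -[leRHS](sum_complete 1 x) (bigD1 j)//= lerDl.
  by apply: sumr_ge0 => i' _; exact: z0.
apply: ler_wpM2r; first exact: weight_ge0.
rewrite poly_evalE (le_trans (ler_norm_sum _ _ _))//.
apply: ler_sum => m _; rewrite normrM ler_piMr// normr_prod.
apply: prodr_ile1 => i _; rewrite normr_ge0/= normrX exprn_ile1//.
by rewrite mxE ger0_norm.
Qed.

Lemma measurable_complete_weight : measurable_fun [set: d.-tuple T]
  (fun x => (weight g (complete 1 x))%:E).
Proof.
apply/measurable_EFinP; apply: measurableT_comp; first exact: measurable_weight.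
exact: measurable_complete.
Qed.

Lemma integrable_poly_weight (f : mpoly d.+1 R) :
  (leb d).-integrable [set: d.-tuple T]
    (fun x => (poly_eval f (simplex_lift x) * weight g (complete 1 x))%:E).
Proof.
pose C := \sum_(m <- msupp f) `|mcoeff m f|.
have iw : (leb d).-integrable [set: d.-tuple T]
    (fun x => C%:E * (weight g (complete 1 x))%:E)%E.
  apply: integrableZl => //; apply/integrableP; split => //.
    exact: measurable_complete_weight.
  under eq_integral do rewrite gee0_abs ?lee_fin ?weight_ge0//.
  exact: integral_weight_lty.
apply: le_integrable iw => //.
  by apply/measurable_EFinP; exact: measurable_poly_weight.
move=> x _; rewrite -EFinM !abse_EFin lee_fin.
by rewrite (le_trans (poly_weight_le _ _))// ler_norm.
Qed.

Definition simplex_form (f : mpoly d.+1 R) : R := simplex_mean g (poly_eval f).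

Lemma simplex_formE f : simplex_form f = simplex_const d g *
  \int[leb d]_x (poly_eval f (simplex_lift x) * weight g (complete 1 x)).
Proof. by rewrite /simplex_form /simplex_mean simplex_integralE. Qed.

Lemma simplex_form_scalar : scalar simplex_form.
Proof.
move=> a u v; rewrite !simplex_formE mulrCA -mulrDr; congr (_ * _).
rewrite -RintegralZl//; last exact: integrable_poly_weight.
rewrite -RintegralD//; last exact: integrable_poly_weight.
  apply: eq_Rintegral => x _.
  by rewrite /poly_eval mevalD mevalZ; ring.
have := integrableZl measurableT a (integrable_poly_weight u).
by apply: eq_integrable => // x _; rewrite EFinM.
Qed.

Lemma simplex_form_permute (m : multinom d.+1) (s : 'S_d.+1) :
  simplex_form (mpolyX R (Multinom [tuple m (s i) | i < d.+1])) =
  simplex_form (mpolyX R m).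
Proof.
rewrite !simplex_formE; congr (_ * fine _).
pose F (z : d.+1.-tuple T) : \bar R :=
  (poly_eval (mpolyX R m) (\row_i tnth z i) * weight g z)%:E.
rewrite -[RHS](@integral_permute _ _ 1 s^-1%g F); last first.
  apply/measurable_EFinP; apply: measurable_funM; last exact: measurable_weight.
  exact: measurable_poly_eval.
apply: eq_integral => x _; rewrite /F weight_permute !poly_evalX.
congr (_ * _)%:E; rewrite [RHS](reindex_inj (@perm_inj _ s)).
apply: eq_bigr => i _; rewrite !mxE tnth_mktuple permK.
by congr (_ ^+ _); rewrite mnmE.
Qed.

End simplex_functional.

(** * Strict inequality between the means of x^3 y and x^2 y^2 *)

Section simplex_positivity.
Context {R : realType}.
Local Notation T := (measurableTypeR R).
Variables (n : nat) (g : R).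
Hypothesis g1 : -1 < g.
Local Notation d := n.+2.

Let i0 : 'I_d.+1 := ord0.
Let i1 : 'I_d.+1 := lift ord0 ord0.

Definition two_mnm (a b : nat) : multinom d.+1 :=
  Multinom [tuple if i == i0 then a else if i == i1 then b else 0%N | i < d.+1].

Lemma poly_eval_two_mnm a b (y : 'rV[R]_d.+1) :
  poly_eval (mpolyX R (two_mnm a b)) y = y 0 i0 ^+ a * y 0 i1 ^+ b.
Proof.
rewrite poly_evalX (bigD1 i0)//= (bigD1 i1)//= big1 ?mulr1; last first.
  by move=> i /andP[/negbTE ni0 /negbTE ni1]; rewrite mnmE ni0 ni1.
by rewrite !mnmE !eqxx.
Qed.

Lemma Rintegral_poly_weight_gt0 (f : mpoly d.+1 R) :
  (0 < \int[leb d]_x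
     (poly_eval f (simplex_lift x) * weight g (complete 1 x))%:E)%E ->
  0 < \int[leb d]_x (poly_eval f (simplex_lift x) * weight g (complete 1 x)).
Proof.
move=> I0; apply: fine_gt0; rewrite I0/=.
exact/integrable_lty/integrable_poly_weight.
Qed.

(** The polynomial x y (x - y)^2 in the first two variables. The coefficients 1 are written out so
    that [scalar] rewrites it term by term. *)
Let G : mpoly d.+1 R := 1 *: mpolyX R (two_mnm 3 1) +
  (1 *: mpolyX R (two_mnm 1 3) + (- 2) *: mpolyX R (two_mnm 2 2)).

Let poly_eval_G y : poly_eval G y = y 0 i0 * y 0 i1 * (y 0 i0 - y 0 i1) ^+ 2.
Proof.
rewrite /G /poly_eval !mevalD !mevalZ.
have E := poly_eval_two_mnm; rewrite /poly_eval in E.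
by rewrite !E; ring.
Qed.

Let integral_G_gt0 : (0 < \int[leb d]_x
  (poly_eval G (simplex_lift x) * weight g (complete 1 x))%:E)%E.
Proof.
apply: lt_le_trans (integral_sqr_diff_gt0 g n) _.
rewrite le_eqVlt; apply/orP; left; apply/eqP.
by apply: eq_integral => x _; rewrite poly_eval_G !mxE.
Qed.

(** The integral of [G] is positive and at most a constant times that of the weight, so the latter
    cannot be 0. *)
Lemma simplex_const_gt0 : 0 < simplex_const d g.
Proof.
rewrite invr_gt0.
have -> : simplex_integral g (fun _ : 'rV[R]_d.+1 => 1) =
    simplex_integral g (poly_eval (1 : mpoly d.+1 R)).
  congr (simplex_integral g _); apply/funext => y.
  by rewrite /poly_eval meval1.
rewrite simplex_integralE; apply: Rintegral_poly_weight_gt0.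
under eq_integral do rewrite /poly_eval meval1 mul1r.
have w0 : (0 <= \int[leb d]_x (weight g (complete 1 x))%:E)%E.
  by apply: integral_ge0 => x _; rewrite lee_fin weight_ge0.
rewrite lt_neqAle w0 andbT; apply/eqP => w0E.
pose C := \sum_(m <- msupp G) `|mcoeff m G|.
suff : (\int[leb d]_x (poly_eval G (simplex_lift x) * weight g (complete 1 x))%:E
    <= C%:E * \int[leb d]_x (weight g (complete 1 x))%:E)%E.
  by rewrite -w0E mule0 leNgt integral_G_gt0.
rewrite -ge0_integralZl_EFin//; last 3 first.
- by move=> x _; rewrite lee_fin weight_ge0.
- exact: measurable_complete_weight.
- by apply: sumr_ge0 => m _.
apply: le_integral => //.
- exact: integrable_poly_weight.
- apply: integrableZl => //; apply/integrableP; split.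
    exact: measurable_complete_weight.
  under eq_integral do rewrite gee0_abs ?lee_fin ?weight_ge0//.
  exact: integral_weight_lty.
- by move=> x _; rewrite -EFinM lee_fin (le_trans (ler_norm _) (poly_weight_le _ _ _)).
Qed.

(** The monomials x^3 y and x y^3 have the same mean, so the positive mean of [G] is twice the
    difference of the two sides. *)
Lemma simplex_form_two_mnm_lt :
  simplex_form g (mpolyX R (two_mnm 2 2)) < simplex_form g (mpolyX R (two_mnm 3 1)).
Proof.
have sym : simplex_form g (mpolyX R (two_mnm 1 3)) =
    simplex_form g (mpolyX R (two_mnm 3 1)).
  rewrite -[RHS](simplex_form_permute g _ (tperm i0 i1)).
  congr (simplex_form g (mpolyX R _)); apply/mnmP => i; rewrite !mnmE.
  by case: tpermP => [->|->|/eqP/negbTE -> /eqP/negbTE ->]; rewrite ?eqxx.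
have : 0 < simplex_form g G.
  rewrite simplex_formE mulr_gt0 ?simplex_const_gt0//.
  exact: Rintegral_poly_weight_gt0 integral_G_gt0.
have form := @simplex_form_scalar R d g g1.
have form0 : simplex_form g (0 : mpoly d.+1 R) = 0.
  by have := form (-1) 0 0; rewrite scaler0 addr0 mulN1r addNr.
have formZ c (u : mpoly d.+1 R) : simplex_form g (c *: u) = c * simplex_form g u.
  by rewrite -[c *: u]addr0 form form0 addr0.
by rewrite /G !form formZ sym; lra.
Qed.

End simplex_positivity.

(** * Comparison of the moments, rescaling of the nodes, and the two rules *)

Section final_steps.
Context {R : realType}.

Lemma vpt_full d : vpt d d.+1 = const_mx 1 :> 'rV[R]_d.+1.
Proof. by apply/rowP => i; rewrite !mxE ltn_ord. Qed.

Lemma two_mnmE n a b : two_mnm n a b = partition_mnm n.+2 [:: a; b].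
Proof.
apply/mnmP => i; rewrite !mnmE.
have [j ->|->] := unliftP ord0 i; last by [].
have [l ->|->] := unliftP ord0 j; last by [].
by rewrite /= nth_nil.
Qed.

(** S_{2,2} has C(d + 1, 2) monomials and S_{3,1} twice as many, so the claim reduces to one
    monomial of each. It makes A_5 positive. *)
Lemma moment31_gt d (g : R) : -1 < g -> (3 <= d)%N ->
  2 * moment d g [:: 2; 2]%N < moment d g [:: 3; 1]%N.
Proof.
move=> g1; case: d => [|[|n]]// d3.
have form l : moment n.+2 g l = poly_eval (monomial_sym n.+2 l) (const_mx 1) *
    simplex_form g (mpolyX R (partition_mnm n.+2 l)).
  rewrite -size_arrangements -form_arrangements//.
    exact: simplex_form_scalar.
  exact: simplex_form_permute.
rewrite !form -!two_mnmE -vpt_full.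
rewrite (@poly_eval_vpt_constant _ _ _ 2 2)//; last by move=> [|[|[|i]]].
rewrite (@poly_eval_vpt_pointed _ _ _ 2 2)//; last by move=> [|[|[|i]]].
rewrite mulrA [2 * _]mulrC ltr_pM2l ?simplex_form_two_mnm_lt//.
by rewrite mulr_gt0// ltr0n bin_gt0.
Qed.

Lemma poly_eval_homogeneous d s (f : mpoly d.+1 R) c y : homogeneous s f ->
  poly_eval f (c *: y) = c ^+ s * poly_eval f y.
Proof.
move=> /allP hf; rewrite !poly_evalE mulr_sumr big_seq [RHS]big_seq.
apply: eq_bigr => m /hf/=/eqP; rewrite mdegE => ms.
rewrite mulrCA; congr (_ * _).
under eq_bigr do rewrite mxE exprMn.
by rewrite big_split/= prodrXr ms.
Qed.

Lemma orbit_pts_simplex d (y : 'rV[R]_d.+1) (c : R) x :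
  0 < c -> (forall i, 0 <= y 0 i) -> \sum_i y 0 i = c ->
  x \in orbit_pts y -> simplex (c^-1 *: x).
Proof.
move=> c0 y0 yc; rewrite mem_orbit_pts => /existsP[s /eqP ->]; split => [i|].
  by rewrite !mxE mulr_ge0// invr_ge0 ltW.
under eq_bigr do rewrite mxE.
rewrite -mulr_sumr; under eq_bigr do rewrite mxE.
have -> : \sum_i y 0 (s i) = c by rewrite -yc [RHS](reindex_inj (@perm_inj _ s)).
by rewrite mulVf// gt_eqF.
Qed.

Lemma sum_vpt d k : (k <= d.+1)%N -> \sum_i vpt d k 0 i = k%:R :> R.
Proof.
move=> kd; under eq_bigr do rewrite mxE.
rewrite -natr_sum -big_mkcond sum1_card -[in RHS](card_ltn_ord kd).
by congr (_%:R); apply: eq_card => i; rewrite inE.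
Qed.

Lemma sum_upt d (a : R) p : (p <= d)%N -> \sum_i upt d a p 0 i = a + p%:R.
Proof.
move=> pd; rewrite big_ord_recl mxE; congr (_ + _).
under eq_bigr do rewrite mxE.
rewrite -natr_sum -big_mkcond sum1_card -[in RHS](card_ltn_ord pd).
by congr (_%:R); apply: eq_card => i; rewrite inE.
Qed.

End final_steps.

Theorem proposition3p3 (R : realType) (d : nat) (gamma : R) (p : nat)
    (k : 'I_4 -> nat) (a : R) (A : 'I_4 -> R) (A5 : R)
    (hd : (3 <= d)%N) (hgamma : -1 < gamma) (hp : (1 <= p <= d)%N)
    (hk : forall j, (1 <= k j <= d.+1)%N) (hkinj : injective k)
    (ha : 0 < a) (ha1 : a != 1)
    (hA5 : A5 = (moment d gamma [:: 3; 1]%N - 2 * moment d gamma [:: 2; 2]%N)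
                / (a * (a - 1) ^+ 2 * p%:R))
    (hA : forall j, 0 < A j)
    (h4 : \sum_j A j * (k j)%:R + A5 * (a ^+ 4 + p%:R)
          = moment d gamma [:: 4]%N)
    (h22 : \sum_j A j * 'C(k j, 2)%:R + A5 * (a ^+ 2 * p%:R + 'C(p, 2)%:R)
           = moment d gamma [:: 2; 2]%N)
    (h211 : 3 * (\sum_j A j * 'C(k j, 3)%:R)
            + A5 * ((a ^+ 2 + 2 * a) * 'C(p, 2)%:R + 3 * 'C(p, 3)%:R)
            = moment d gamma [:: 2; 1; 1]%N)
    (h1111 : \sum_j A j * 'C(k j, 4)%:R + A5 * (a * 'C(p, 3)%:R + 'C(p, 4)%:R)
             = moment d gamma [:: 1; 1; 1; 1]%N) :
  let lambda j := A j * (k j)%:R ^+ 4 in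
  let lambda5 := A5 * (a + p%:R) ^+ 4 in
  [/\ (* the first rule is positive ... *)
      (forall j, 0 < A j / 'C(d.+1, k j)%:R) /\
      0 < A5 / (d.+1%:R * 'C(d, p)%:R),
      (* ... and of index 4 *)
      forall f : mpoly d.+1 R, homogeneous 4 f ->
        simplex_mean gamma (poly_eval f) =
          \sum_j A j / 'C(d.+1, k j)%:R *
            \sum_(x <- orbit_pts (vpt d (k j))) poly_eval f x
          + A5 / (d.+1%:R * 'C(d, p)%:R) *
            \sum_(x <- orbit_pts (upt d a p)) poly_eval f x,
      (* the second rule is positive ... *)
      (forall j, 0 < lambda j / 'C(d.+1, k j)%:R) /\
      0 < lambda5 / (d.+1%:R * 'C(d, p)%:R),
      (* ... and of index 4 ... *)
      forall f : mpoly d.+1 R, homogeneous 4 f ->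
        simplex_mean gamma (poly_eval f) =
          \sum_j lambda j / 'C(d.+1, k j)%:R *
            \sum_(x <- orbit_pts (vpt d (k j)))
              poly_eval f ((k j)%:R^-1 *: x)
          + lambda5 / (d.+1%:R * 'C(d, p)%:R) *
            \sum_(x <- orbit_pts (upt d a p))
              poly_eval f ((a + p%:R)^-1 *: x) &
      (* ... with all nodes in the simplex *)
      (forall j x, x \in orbit_pts (vpt d (k j)) ->
         @simplex R d ((k j)%:R^-1 *: x)) /\
      (forall x, x \in orbit_pts (upt d a p) ->
         @simplex R d ((a + p%:R)^-1 *: x)) ].
Proof.
move: hp => /andP[p0 pd] lambda lambda5.
have k0 j : (0 < k j)%N by have /andP[] := hk j.
have kd j : (k j <= d.+1)%N by have /andP[] := hk j.
have p_gt0 : 0 < p%:R :> R by rewrite ltr0n.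
have m31 := moment31_gt hgamma hd.
have sq_gt0 : 0 < (a - 1) ^+ 2.
  by rewrite lt_neqAle sqr_ge0 eq_sym sqrf_eq0 subr_eq0 ha1.
have A50 : 0 < A5 by rewrite hA5 divr_gt0 ?subr_gt0 ?(mulr_gt0 (mulr_gt0 _ _)).
have bin_k j : 0 < 'C(d.+1, k j)%:R :> R by rewrite ltr0n bin_gt0.
have bin_p : 0 < d.+1%:R * 'C(d, p)%:R :> R by rewrite mulr_gt0// ltr0n bin_gt0.
have k_gt0 j : 0 < (k j)%:R :> R by rewrite ltr0n.
have ap_gt0 : 0 < a + p%:R by rewrite addr_gt0.
pose E : mpoly d.+1 R -> R := simplex_form gamma.
pose L (f : mpoly d.+1 R) : R :=
  \sum_j A j / 'C(d.+1, k j)%:R * orbit_form (vpt d (k j)) f +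
  A5 / (d.+1%:R * 'C(d, p)%:R) * orbit_form (upt d a p) f.
have scalarL : scalar L.
  move=> c u v; rewrite /L orbit_form_scalar.
  under eq_bigr do rewrite orbit_form_scalar mulrDr mulrCA.
  by rewrite big_split/= -mulr_sumr; ring.
have symL : symmetric_form L.
  move=> m s; rewrite /L orbit_form_symmetric; congr (_ + _).
  by apply: eq_bigr => j _; rewrite orbit_form_symmetric.
(* The denominators of the weights are the orbit sizes and S_l is constant on an orbit, so one value
   per orbit remains. *)
have L_sym l : L (monomial_sym d l) =
    \sum_j A j * poly_eval (monomial_sym d l) (vpt d (k j)) +
    A5 * poly_eval (monomial_sym d l) (upt d a p).
  rewrite /L; congr (_ + _).
    apply: eq_bigr => j _; rewrite orbit_form_monomial_sym size_orbit_vpt//.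
    by rewrite mulrA divfK// gt_eqF.
  rewrite orbit_form_monomial_sym size_orbit_upt ?(gt_eqF ha)// natrM.
  by rewrite mulrA divfK// gt_eqF.
have rule1 f : homogeneous 4 f -> E f = L f.
  apply: degree4_forms_eq => //.
  - exact: simplex_form_scalar.
  - exact: simplex_form_permute.
  have momentE l : E (monomial_sym d l) = moment d gamma l by [].
  have d0 : (0 < d)%N by exact: leq_trans hd.
  have d1 : (1 < d)%N by exact: leq_trans hd.
  move=> l; rewrite momentE L_sym !inE.
  case/or4P => [/eqP ->|/eqP ->|/eqP ->|/orP[]/eqP ->].
  (* The partition {4} is read as a single large exponent 3 + 1 followed by no ones. *)
  - rewrite -h4 (@poly_eval_upt_pointed _ _ _ 0 3)//; last by move=> [|[|i]].
    congr (_ + _); last by rewrite bin0 bin1; ring.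
    apply: eq_bigr => j _; congr (_ * _).
    rewrite (@poly_eval_vpt_pointed _ _ _ 1 3)//; last by move=> [|[|i]].
    by rewrite bin1 mulr1.
  (* Solving [hA5] for this moment leaves twice [h22] and the term a(a-1)^2 p, which turns 2 S_{2,2}
     into S_{3,1} at u_{a,p}. *)
  - have -> : moment d gamma [:: 3; 1]%N =
        2 * moment d gamma [:: 2; 2]%N + A5 * (a * (a - 1) ^+ 2 * p%:R).
      rewrite hA5 divfK; first by ring.
      by rewrite gt_eqF ?(mulr_gt0 (mulr_gt0 _ _)).
    rewrite -h22 (@poly_eval_upt_pointed _ _ _ 1 2)//; last by move=> [|[|[|i]]].
    have -> : \sum_j A j * poly_eval (monomial_sym d [:: 3; 1]%N) (vpt d (k j)) =
        2 * \sum_j A j * 'C(k j, 2)%:R.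
      rewrite mulr_sumr; apply: eq_bigr => j _.
      rewrite (@poly_eval_vpt_pointed _ _ _ 2 2)//; last by move=> [|[|[|i]]].
      by ring.
    by rewrite bin1; ring.
  - rewrite -h22 (@poly_eval_upt_constant _ _ _ 1 2)//; last by move=> [|[|[|i]]].
    congr (_ + _); last by rewrite bin1; ring.
    apply: eq_bigr => j _; congr (_ * _).
    by rewrite (@poly_eval_vpt_constant _ _ _ 2 2)//; move=> [|[|[|i]]].
  - rewrite -h211 (@poly_eval_upt_pointed _ _ _ 2 1)//; last by move=> [|[|[|[|i]]]].
    congr (_ + _); last by ring.
    rewrite mulr_sumr; apply: eq_bigr => j _.
    rewrite (@poly_eval_vpt_pointed _ _ _ 3 1)//; last by move=> [|[|[|[|i]]]].
    by ring.
  - rewrite -h1111 (@poly_eval_upt_constant _ _ _ 3 1)//; last by move=> [|[|[|[|[|i]]]]].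
    congr (_ + _); last by ring.
    apply: eq_bigr => j _; congr (_ * _).
    by rewrite (@poly_eval_vpt_constant _ _ _ 4 1)//; move=> [|[|[|[|[|i]]]]].
have lambda_gt0 j : 0 < lambda j by rewrite mulr_gt0// exprn_gt0.
have lambda5_gt0 : 0 < lambda5 by rewrite mulr_gt0// exprn_gt0.
(* Applied with [x] the fourth power of the coordinate sum of a node: by homogeneity, dividing the
   node by this sum divides f by [x], and the factor [x] in the new weight compensates. *)
have rescale (w x B S : R) : x != 0 -> w / B * S = w * x / B * (x^-1 * S).
  by move=> x0; rewrite [w * x / B]mulrAC -[RHS]mulrA mulVKf.
split.
- by split=> [j|]; rewrite divr_gt0.
- exact: rule1.
- by split=> [j|]; rewrite divr_gt0.
- move=> f hf; transitivity (L f); first exact: rule1.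
  congr (_ + _).
    apply: eq_bigr => j _.
    under [in RHS]eq_bigr do rewrite (poly_eval_homogeneous _ _ hf).
    by rewrite -mulr_sumr /lambda exprVn -rescale// gt_eqF ?exprn_gt0.
  under [in RHS]eq_bigr do rewrite (poly_eval_homogeneous _ _ hf).
  by rewrite -mulr_sumr /lambda5 exprVn -rescale// gt_eqF ?exprn_gt0.
- split=> [j x|x]; apply: orbit_pts_simplex => //.
  + by move=> i; rewrite mxE.
  + exact: sum_vpt.
  + by move=> i; rewrite mxE; case: ifP => // _; exact: ltW.
  + exact: sum_upt.
Qed.
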